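(* (1) Let $X$ be a Banach space containing an isomorphic copy of $\ell_1$. Then $\operatorname{bs}(B_X)=2$. In particular $\operatorname{bs}(B_{\ell_1})=2$ and $\operatorname{wbs}(B_{\ell_1})=0$. (2) Let $X$ be a nonreflexive Banach space containing no isomorphic copy of $\ell_1$. Then $\operatorname{bs}(B_X)\in[1,2]$. In particular $\operatorname{bs}(B_{c_0})=1$, $\operatorname{bs}(B_c)=2$ and $\operatorname{wbs}(B_{c_0})=\operatorname{wbs}(B_c)=0$.
   Context: $B_X$ is the closed unit ball of $X$; $c_0$ is the space of null sequences and $c$ the space of convergent sequences, both with the supremum norm. For a bounded sequence: $\operatorname{ca}(x_k)=\inf_{n}\sup\{\|x_k-x_l\|: k,l\ge n\}$, $\operatorname{cca}(x_k)=\operatorname{ca}(\frac1k\sum_{i=1}^k x_i)$, $\widetilde{\operatorname{cca}}(x_k)=\inf$ of $\operatorname{cca}$ over all subsequences. $\operatorname{bs}(A)=\sup\{\widetilde{\operatorname{cca}}(x_k): (x_k)\subset A\}$ and $\operatorname{wbs}(A)=\sup\{\widetilde{\operatorname{cca}}(x_k): (x_k)\subset A\text{ weakly convergent}\}$. *)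

(* Defs.v *)
From mathcomp Require Import all_boot all_algebra.
From mathcomp Require Import all_classical all_reals all_analysis.
Set Implicit Arguments. Unset Strict Implicit. Unset Printing Implicit Defensive.
Import GRing.Theory Num.Theory numFieldNormedType.Exports.
Local Open Scope classical_set_scope.
Local Open Scope ring_scope.

(* A (real) normed space is presented here as a subspace [S] of a real vector
   space [V] together with a norm [N : V -> R] (only its values on [S] matter).
   For a genuine Banach space X we take V := X, S := setT, N := norm of X;
   for the sequence spaces l_1, c_0, c we take V := nat -> R. *)
Section Quantities.
Variables (R : realType) (V : lmodType R).

Definition ca (N : V -> R) (x : nat -> V) : R :=
  inf (range (fun n => sup [set r | exists k l,
          (n <= k)%N /\ (n <= l)%N /\ r = N (x k - x l)])).

(* Cesaro means: avg x k = (1/(k+1)) (x_0 + ... + x_k)  (paper: indices 1..k) *)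
Definition cesaro (x : nat -> V) (k : nat) : V :=
  (k.+1%:R)^-1 *: \sum_(i < k.+1) x i.

Definition cca (N : V -> R) (x : nat -> V) : R := ca N (cesaro x).

Definition ccat (N : V -> R) (x : nat -> V) : R :=
  inf [set r | exists phi : nat -> nat,
         (forall n, (phi n < phi n.+1)%N) /\ r = cca N (fun n => x (phi n))].

Definition bs (N : V -> R) (A : set V) : R :=
  sup [set r | exists x : nat -> V, (forall n, A (x n)) /\ r = ccat N x].

Definition bdd_lin_fun (S : set V) (N : V -> R) (f : V -> R) : Prop :=
  (forall (a : R) u v, S u -> S v -> f (a *: u + v) = a * f u + f v) /\
  exists M : R, forall v, S v -> `|f v| <= M * N v.

Definition weak_cvg (S : set V) (N : V -> R) (x : nat -> V) (y : V) : Prop :=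
  S y /\ forall f, bdd_lin_fun S N f -> (fun n => f (x n)) @ \oo --> f y.

Definition wbs (S : set V) (N : V -> R) (A : set V) : R :=
  sup [set r | exists (x : nat -> V) (y : V),
         (forall n, A (x n)) /\ weak_cvg S N x y /\ r = ccat N x].

Definition dual_norm (S : set V) (N : V -> R) (f : V -> R) : R :=
  sup [set r | exists v, S v /\ N v <= 1 /\ r = `|f v|].

Definition reflexive (S : set V) (N : V -> R) : Prop :=
  forall phi : (V -> R) -> R,
    (forall (a : R) f g, bdd_lin_fun S N f -> bdd_lin_fun S N g ->
        phi (fun v => a * f v + g v) = a * phi f + phi g) ->
    (exists M : R, forall f, bdd_lin_fun S N f -> `|phi f| <= M * dual_norm S N f) ->
    exists x, S x /\ forall f, bdd_lin_fun S N f -> phi f = f x.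

End Quantities.

Section SequenceSpaces.
Variable (R : realType).

Definition l1_set : set (nat -> R) :=
  [set a | exists l : R, series (fun i => `|a i|) @ \oo --> l].
Definition l1norm (a : nat -> R) : R := lim (series (fun i => `|a i|) @ \oo).
Definition l1_ball : set (nat -> R) := [set a | l1_set a /\ l1norm a <= 1].

Definition supnorm (a : nat -> R) : R := sup (range (fun i => `|a i|)).
Definition c0_set : set (nat -> R) := [set a | a @ \oo --> 0].
Definition c_set : set (nat -> R) := [set a | exists l : R, a @ \oo --> l].
Definition c0_ball : set (nat -> R) := [set a | c0_set a /\ supnorm a <= 1].
Definition c_ball : set (nat -> R) := [set a | c_set a /\ supnorm a <= 1].

End SequenceSpaces.

Section BanachNotions.
Variables (R : realType) (X : normedModType R).

Definition unit_ball : set X := [set x | `|x| <= 1].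

Definition Xnorm (x : X) : R := `|x|.

Definition contains_l1 : Prop :=
  exists (T : (nat -> R) -> X) (c C : R), 0 < c /\
    (forall (k : R) a b, l1_set a -> l1_set b -> T (k *: a + b) = k *: T a + T b) /\
    (forall a, l1_set a -> c * l1norm a <= `|T a| /\ `|T a| <= C * l1norm a).

Definition reflexive_space : Prop := reflexive [set: X] Xnorm.

End BanachNotions.

(* Main.v *)
(** Lower bounds for [bs] come from comparing the Cesaro means of orders k < l of a
    subsequence, with k fixed and l -> oo: if norm-one functionals [f n] satisfy
    [f n (x j) = al] for [n <= j] and [be] for [j < n], the two means end up [al - be]
    apart.  In [c_0], [c] and [l_1] the summing-type sequences do this.  If [X] contains
    [l_1], James's distortion theorem gives blocks that behave almost isometrically like
    the unit vectors of [l_1].  If [X] is not reflexive, James's construction (Riesz's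
    lemma in the bidual, then alternately Helly-type extension in [X] and in its dual)
    gives such a triangular array with [al = th < 1] and [be = 0].

    Upper bounds come from gliding humps.  In [c_0] and [c], after passing to a
    subsequence each coordinate takes, up to a small error and one exceptional term,
    first one value and then another one, so that all Cesaro means lie near the segment
    between them.  In [l_1] weakly convergent sequences are norm convergent (Schur). *)
From mathcomp Require Import all_boot all_order all_algebra.
From mathcomp Require Import all_classical all_reals all_analysis.
From mathcomp Require Import ring lra.
Require Import Defs.
Set Implicit Arguments. Unset Strict Implicit. Unset Printing Implicit Defensive.
Import Order.TTheory GRing.Theory Num.Theory numFieldNormedType.Exports.
Local Open Scope classical_set_scope.
Local Open Scope ring_scope.

(** * Seminorms on subspaces and the quantities [ca], [ccat], [bs], [wbs] *)

Section Seminorms.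
Variables (R : realType) (V : lmodType R).
Implicit Types (S A : set V) (N : V -> R) (x : nat -> V) (phi : nat -> nat).

Definition subspace S := S 0 /\ forall (a : R) u v, S u -> S v -> S (a *: u + v).

Definition linear_on S (f : V -> R) :=
  forall (a : R) u v, S u -> S v -> f (a *: u + v) = a * f u + f v.

(** Relative to a subspace because the norms in play behave as such only there: [supnorm] on
    [c_set], [l1norm] on [l1_set], [dual_norm] on the bounded functionals among all functions. *)
Record seminorm_on S N : Prop := SeminormOn {
  seminorm_subspace : subspace S;
  seminormD : forall u v, S u -> S v -> N (u + v) <= N u + N v;
  seminormZ : forall (a : R) u, S u -> N (a *: u) = `|a| * N u }.

Lemma subspaceD S u v : subspace S -> S u -> S v -> S (u + v).
Proof. by move=> [_ h] Su Sv; rewrite -[u]scale1r; apply: h. Qed.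

Lemma subspaceZ S (a : R) u : subspace S -> S u -> S (a *: u).
Proof. by move=> [S0 h] Su; rewrite -[_ *: _]addr0; apply: h. Qed.

Lemma subspaceB S u v : subspace S -> S u -> S v -> S (u - v).
Proof.
by move=> hS Su Sv; rewrite -scaleN1r; apply: subspaceD => //; apply: subspaceZ.
Qed.

Lemma subspace_sum S (x : nat -> V) n : subspace S -> (forall i, S (x i)) ->
  S (\sum_(i < n) x i).
Proof.
move=> hS Sx; elim: n => [|n IH]; first by rewrite big_ord0; case: hS.
by rewrite big_ord_recr /=; apply: subspaceD.
Qed.

Lemma linear_on0 S f : subspace S -> linear_on S f -> f 0 = 0.
Proof.
move=> [S0 _] lf; have := lf 1 0 0 S0 S0.
by rewrite scale1r addr0 mul1r => /eqP; rewrite -subr_eq0 opprD addNKr oppr_eq0 => /eqP.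
Qed.

Lemma linear_onD S f u v : subspace S -> linear_on S f -> S u -> S v ->
  f (u + v) = f u + f v.
Proof. by move=> hS lf Su Sv; have := lf 1 u v Su Sv; rewrite scale1r mul1r. Qed.

Lemma linear_onZ S f (a : R) u : subspace S -> linear_on S f -> S u ->
  f (a *: u) = a * f u.
Proof.
move=> hS lf Su; have := lf a u 0 Su hS.1.
by rewrite addr0 (linear_on0 hS lf) addr0.
Qed.

Lemma linear_onB S f u v : subspace S -> linear_on S f -> S u -> S v ->
  f (u - v) = f u - f v.
Proof.
move=> hS lf Su Sv; rewrite -scaleN1r (linear_onD hS lf) ?(linear_onZ _ hS lf) //.
  by rewrite mulN1r.
exact: subspaceZ.
Qed.

Lemma linear_on_sum S f (x : nat -> V) n : subspace S -> linear_on S f ->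
  (forall i, S (x i)) -> f (\sum_(i < n) x i) = \sum_(i < n) f (x i).
Proof.
move=> hS lf Sx; elim: n => [|n IH]; first by rewrite !big_ord0 (linear_on0 hS lf).
by rewrite !big_ord_recr /= (linear_onD hS lf) ?IH //; apply: (subspace_sum n hS Sx).
Qed.

(** The reverse homogeneity inequality is the given one for the scalar [a^-1] at the vector
    [a *: u]; nonnegativity covers [a = 0]. *)
Lemma seminorm_on_of_le S N : subspace S -> (forall u, S u -> 0 <= N u) ->
  (forall u v, S u -> S v -> N (u + v) <= N u + N v) ->
  (forall (a : R) u, S u -> N (a *: u) <= `|a| * N u) -> seminorm_on S N.
Proof.
move=> hS N0 ND NZ; split => // a u Su; apply/eqP; rewrite eq_le NZ //=.
have [->|a0] := eqVneq a 0.
  by rewrite normr0 mul0r scale0r N0 //; case: hS.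
rewrite -ler_pdivlMl ?normr_gt0 // -normfV.
have {1}-> : u = a^-1 *: (a *: u) by rewrite scalerA mulVf // scale1r.
by apply: NZ; apply: subspaceZ.
Qed.

Lemma seminorm_on_sub S' S N : S' `<=` S -> subspace S' -> seminorm_on S N ->
  seminorm_on S' N.
Proof.
move=> SS hS hN; split => // [u v Su Sv|a u Su]; first by apply: (seminormD hN); apply: SS.
by apply: (seminormZ hN); apply: SS.
Qed.

(** * Cesaro means and general bounds for [ca], [ccat], [bs] and [wbs] *)

Section OneSeminorm.
Variables (S : set V) (N : V -> R).
Hypothesis hN : seminorm_on S N.
Let hS := seminorm_subspace hN.

Lemma seminorm0 : N 0 = 0.
Proof. by rewrite -(scale0r 0) (seminormZ hN) ?normr0 ?mul0r //; case: hS. Qed.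

Lemma seminormN u : S u -> N (- u) = N u.
Proof. by move=> Su; rewrite -scaleN1r (seminormZ hN) // normrN1 mul1r. Qed.

Lemma seminorm_ge0 u : S u -> 0 <= N u.
Proof.
move=> Su; have := seminormD hN Su (subspaceZ (-1) hS Su).
rewrite scaleN1r subrr seminorm0 seminormN // => h; lra.
Qed.

Lemma seminormB u v : S u -> S v -> N (u - v) <= N u + N v.
Proof.
move=> Su Sv; rewrite -(seminormN Sv); apply: (seminormD hN) => //.
by rewrite -scaleN1r; apply: subspaceZ.
Qed.

Lemma subspace_cesaro x k : (forall n, S (x n)) -> S (cesaro x k).
Proof. by move=> Sx; apply: subspaceZ => //; exact: (subspace_sum k.+1 hS Sx). Qed.

Lemma seminorm_cesaroB_le x y (r : R) k : (forall n, S (x n)) -> S y ->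
  (forall n, N (x n - y) <= r) -> N (cesaro x k - y) <= r.
Proof.
move=> Sx Sy xr.
have -> : cesaro x k - y = (k.+1%:R)^-1 *: \sum_(i < k.+1) (x i - y).
  rewrite sumrB scalerBr sumr_const card_ord -(scaler_nat _ y) scalerA mulVf ?pnatr_eq0 //.
  by rewrite scale1r.
have Sxy i : S (x i - y) by apply: subspaceB.
rewrite (seminormZ hN); last exact: (subspace_sum k.+1 hS Sxy).
rewrite ger0_norm ?invr_ge0 ?ler0n // ler_pdivrMl ?ltr0n //.
elim: (k.+1) => [|n IH]; first by rewrite big_ord0 seminorm0 mul0r.
rewrite big_ord_recr /= -[n.+1]addn1 natrD mulrDl mul1r.
apply: le_trans (seminormD hN _ _) _ => //; last exact: lerD.
exact: (subspace_sum n hS Sxy).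
Qed.

Lemma seminorm_cesaro_le x (r : R) k : (forall n, S (x n)) -> (forall n, N (x n) <= r) ->
  N (cesaro x k) <= r.
Proof.
move=> Sx xr; rewrite -[cesaro x k]subr0; apply: seminorm_cesaroB_le => //.
  by case: hS.
by move=> n; rewrite subr0.
Qed.

Let osc x n := [set r | exists k l, (n <= k)%N /\ (n <= l)%N /\ r = N (x k - x l)].

Let osc0 x n : osc x n 0.
Proof. by exists n, n; rewrite subrr seminorm0. Qed.

Let osc_ge0 x n : (forall n, S (x n)) -> 0 <= sup (osc x n).
Proof.
move=> Sx; have [hs|hs] := pselect (has_sup (osc x n)); last by rewrite sup_out.
by apply: ub_le_sup (osc0 x n); case: hs.
Qed.

Lemma ca_ge0 x : (forall n, S (x n)) -> 0 <= ca N x.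
Proof.
move=> Sx; apply: lb_le_inf; first by exists (sup (osc x 0)); exists 0%N.
by move=> r [n _ <-]; apply: osc_ge0.
Qed.

Lemma ca_le x (r : R) n : (forall n, S (x n)) ->
  (forall k l, (n <= k)%N -> (n <= l)%N -> N (x k - x l) <= r) -> ca N x <= r.
Proof.
move=> Sx h; apply: le_trans (_ : sup (osc x n) <= r).
  apply: ge_inf; last by exists n.
  by exists 0 => _ [m _ <-]; apply: osc_ge0.
apply: ge_sup; first by exists 0; apply: osc0.
by move=> _ [k [l [nk [nl ->]]]]; apply: h.
Qed.

(** The bound [M] makes every oscillation set bounded above, so that its [sup] really dominates the
    chosen pair. *)
Lemma le_ca x (r M : R) : (forall n, S (x n)) -> (forall n, N (x n) <= M) ->
  (forall n (e : R), 0 < e -> exists k l,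
     [/\ (n <= k)%N, (n <= l)%N & r - e <= N (x k - x l)]) ->
  r <= ca N x.
Proof.
move=> Sx xM h; apply: lb_le_inf; first by exists (sup (osc x 0)); exists 0%N.
move=> _ [n _ <-]; apply/ler_addgt0Pr => e e0.
have [k [l [nk nl kl]]] := h n e e0.
rewrite -lerBlDr; apply: le_trans kl _; apply: ub_le_sup; last by exists k, l.
by exists (M + M) => _ [i [j [_ [_ ->]]]]; apply: le_trans (seminormB _ _) (lerD _ _).
Qed.

Lemma cca_ge0 x : (forall n, S (x n)) -> 0 <= cca N x.
Proof. by move=> Sx; apply: ca_ge0 => n; apply: subspace_cesaro. Qed.

Lemma cca_le2 x : (forall n, S (x n)) -> (forall n, N (x n) <= 1) -> cca N x <= 2.
Proof.
move=> Sx x1; apply: (@ca_le _ _ 0) => [n|k l _ _]; first exact: subspace_cesaro.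
apply: le_trans (seminormB _ _) _; try exact: subspace_cesaro.
have -> : 2 = 1 + 1 :> R by [].
by apply: lerD; apply: seminorm_cesaro_le.
Qed.

Lemma ccat_le x phi (r : R) : (forall n, S (x n)) -> (forall n, (phi n < phi n.+1)%N) ->
  cca N (x \o phi) <= r -> ccat N x <= r.
Proof.
move=> Sx iphi h; apply: le_trans h; apply: ge_inf; last by exists phi.
by exists 0 => _ [psi [_ ->]]; apply: cca_ge0.
Qed.

Lemma le_ccat x (r : R) :
  (forall phi, (forall n, (phi n < phi n.+1)%N) -> r <= cca N (x \o phi)) ->
  r <= ccat N x.
Proof.
move=> h; apply: lb_le_inf; last by move=> _ [phi [iphi ->]]; apply: h.
by exists (cca N (fun n => x n)); exists id; split.
Qed.

Lemma ccat_ge0 x : (forall n, S (x n)) -> 0 <= ccat N x.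
Proof. by move=> Sx; apply: le_ccat => phi _; apply: cca_ge0 => n /=. Qed.

Lemma ccat_le2 x : (forall n, S (x n)) -> (forall n, N (x n) <= 1) -> ccat N x <= 2.
Proof. by move=> Sx x1; apply: (@ccat_le _ id) => //; apply: cca_le2. Qed.

Variable B : set V.
Hypothesis BE : forall v, B v <-> S v /\ N v <= 1.

Let B0 : B 0.
Proof. by apply/BE; rewrite seminorm0; split => //; case: hS. Qed.

Lemma bs_le (r : R) : (forall x, (forall n, B (x n)) -> ccat N x <= r) -> bs N B <= r.
Proof.
move=> h; apply: ge_sup; last by move=> _ [x [Bx ->]]; apply: h.
by exists (ccat N (fun=> 0)); exists (fun=> 0).
Qed.

Lemma bs_le2 : bs N B <= 2.
Proof. by apply: bs_le => x Bx; apply: ccat_le2 => n; have [] := (BE (x n)).1 (Bx n). Qed.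

Lemma le_bs x (r : R) : (forall n, B (x n)) -> r <= ccat N x -> r <= bs N B.
Proof.
move=> Bx h; apply: le_trans h _; apply: ub_le_sup; last by exists x.
exists 2 => _ [y [By ->]].
by apply: ccat_le2 => n; have [] := (BE (y n)).1 (By n).
Qed.

(** As [ccat] is a nonnegative infimum over subsequences, one good subsequence for each [e] makes it
    vanish; the set in [wbs] is then {0}, the zero sequence providing a member. *)
Lemma wbs_eq0 :
  (forall x y (e : R), (forall n, B (x n)) -> weak_cvg S N x y -> 0 < e ->
     exists2 phi, (forall n, (phi n < phi n.+1)%N) & cca N (x \o phi) <= e) ->
  wbs S N B = 0.
Proof.
move=> h.
have ccat0 x y : (forall n, B (x n)) -> weak_cvg S N x y -> ccat N x = 0.
  move=> Bx xy; have Sx n : S (x n) by have [] := (BE (x n)).1 (Bx n).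
  apply/eqP; rewrite eq_le ccat_ge0 // andbT.
  apply/ler_addgt0Pr => e e0; rewrite add0r.
  by have [phi iphi le] := h x y e Bx xy e0; apply: ccat_le le.
rewrite /wbs (_ : [set r | _] = [set 0]) ?sup1 //; apply/seteqP; split.
  by move=> _ [x [y [Bx [xy ->]]]] /=; apply: ccat0 xy.
have w0 : weak_cvg S N (fun=> 0) 0 by split=> [|f _]; [case: hS|apply: cvg_cst].
by move=> _ ->; exists (fun=> 0), 0; split => //; split => //; rewrite (ccat0 _ 0).
Qed.

(** For fixed [k] the factor [(l - k) / (l + 1)] tends to 1, so the Cesaro means oscillate by at
    least [d] arbitrarily late. The gap is asked along every subsequence because [ccat] is an
    infimum over them. *)
Lemma le_bs_of_gap x (d : R) : 0 <= d -> (forall n, B (x n)) ->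
  (forall phi k l, (forall n, (phi n < phi n.+1)%N) -> (k < l)%N ->
     d * ((l - k)%:R / l.+1%:R) <= N (cesaro (x \o phi) k - cesaro (x \o phi) l)) ->
  d <= bs N B.
Proof.
move=> d0 Bx h; have Sx n : S (x n) by have [] := (BE (x n)).1 (Bx n).
have x1 n : N (x n) <= 1 by have [] := (BE (x n)).1 (Bx n).
apply: (le_bs Bx); apply: le_ccat => phi iphi; apply: (@le_ca _ _ 1) => [n|n|n e e0].
- by apply: subspace_cesaro => i /=.
- by apply: seminorm_cesaro_le => i /=.
(* The factor is [1 - (n + 1) / (l + 1)]; this [l] is large enough for
   [d * (n + 1) / (l + 1) <= e]. *)
pose l := (n + (Num.truncn (d * n.+1%:R / e)).+1)%N.
have nl : (n < l)%N by rewrite /l addnS ltnS leq_addr.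
exists n, l; split => //; first exact: ltnW.
apply: le_trans (h phi n l iphi nl).
have -> : (l - n)%:R / l.+1%:R = 1 - n.+1%:R / l.+1%:R :> R.
  rewrite -[X in X - _](@divff _ l.+1%:R) ?pnatr_eq0 // -mulrBl -natrB ?ltnS 1?ltnW //.
rewrite mulrBr mulr1 lerD2l lerN2 mulrA ler_pdivrMr ?ltr0n // mulrC -ler_pdivrMl //.
rewrite mulrC mulrC [e^-1 * _]mulrC (le_trans (ltW (truncnS_gt _))) // ler_nat /l.
by rewrite [n.+1%:R * d]mulrC; apply: leqW; apply: leq_addl.
Qed.

(** The switch from [be] to [al] is placed at [phi k.+1]: the mean of order [k] sees only [be],
    while the mean of order [l] sees [k + 1] times [be] and [l - k] times [al]. *)
Lemma cesaro_gap_functional (f : V -> R) x phi (al be : R) k l :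
  linear_on setT f -> (forall n, (phi n < phi n.+1)%N) -> (k < l)%N ->
  (forall j, (j <= phi l)%N -> f (x j) = if (phi k.+1 <= j)%N then al else be) ->
  `|f (cesaro (x \o phi) k - cesaro (x \o phi) l)| =
  `|al - be| * ((l - k)%:R / l.+1%:R).
Proof.
move=> lf iphi kl fx.
have sT : subspace [set: V] by [].
have mphi : {mono phi : m n / (m <= n)%N}.
  by apply: leq_mono => i j; elim: j => // j IH; rewrite ltnS leq_eqVlt
    => /predU1P[->|/IH /ltn_trans]; [apply: iphi|apply; apply: iphi].
have fc m : f (cesaro (x \o phi) m) = (m.+1%:R)^-1 * \sum_(i < m.+1) f (x (phi i)).
  rewrite (linear_onZ _ sT lf) //; congr (_ * _).
  exact: (linear_on_sum m.+1 sT lf (fun i => I : [set: V] ((x \o phi) i))).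
rewrite (linear_onB sT lf) // !fc.
have -> : \sum_(i < k.+1) f (x (phi i)) = k.+1%:R * be.
  under eq_bigr => i _.
    rewrite fx; last by rewrite mphi (leq_trans _ kl) // ltnW.
    rewrite mphi ltnNge -ltnS ltn_ord /=; over.
  by rewrite sumr_const card_ord mulr_natl.
have -> : \sum_(i < l.+1) f (x (phi i)) = k.+1%:R * be + (l - k)%:R * al.
  have -> : l.+1 = (k.+1 + (l - k))%N by rewrite addSn subnKC // ltnW.
  rewrite big_split_ord /=; congr (_ + _).
    under eq_bigr => i _.
      rewrite fx; last by rewrite mphi (leq_trans _ kl) // ltnW.
      rewrite mphi ltnNge -ltnS ltn_ord /=; over.
    by rewrite sumr_const card_ord mulr_natl.
  under eq_bigr => i _.
    rewrite fx; last first.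
      by rewrite mphi addSn -[X in (_ <= X)%N](subnKC (ltnW kl)) -addnS leq_add2l.
    rewrite mphi leq_addr; over.
  by rewrite sumr_const card_ord mulr_natl.
have lE : l.+1%:R = k.+1%:R + (l - k)%:R :> R by rewrite -natrD addSn subnKC // ltnW.
have k0 : k.+1%:R != 0 :> R by rewrite pnatr_eq0.
have l0 : l.+1%:R != 0 :> R by rewrite pnatr_eq0.
have t0 : 0 <= (l - k)%:R / l.+1%:R :> R by rewrite divr_ge0 ?ler0n.
rewrite -(ger0_norm t0) -normrM -normrN; congr `|_|.
move: k0 l0 lE; move: (k.+1%:R) (l.+1%:R) ((l - k)%:R) => a b c a0 b0 bE.
rewrite bE in b0 *; field; exact/andP.
Qed.

(** The hypothesis survives passing to a subsequence: take [n = phi k.+1] and [m = phi l]. Since the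
    mean of order [l] involves no index beyond [phi l], values on a finite range suffice. *)
Lemma le_bs_of_functionals x (al be : R) :
  be <= al -> (forall n, B (x n)) ->
  (forall n m, exists f, [/\ linear_on setT f, (forall v, S v -> `|f v| <= N v) &
     forall j, (j <= m)%N -> f (x j) = if (n <= j)%N then al else be]) ->
  al - be <= bs N B.
Proof.
move=> ab Bx h; have Sx n : S (x n) by have [] := (BE (x n)).1 (Bx n).
apply: (@le_bs_of_gap x); rewrite ?subr_ge0 // => phi k l iphi kl.
have [f [lf fN fx]] := h (phi k.+1) (phi l).
rewrite -[al - be]ger0_norm ?subr_ge0 // -(cesaro_gap_functional lf iphi kl fx).
by apply: fN; apply: subspaceB => //; apply: subspace_cesaro => n /=.
Qed.

End OneSeminorm.
End Seminorms.

(** * Extension of dominated functionals *)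

Section HahnBanach.
Variables (R : realType) (V : lmodType R).
Implicit Types (S : set V) (p : V -> R).

(** Partial functionals are given by their graphs, so that Zorn's lemma applies to inclusion.
    Single-valuedness is not imposed; it follows from domination by a seminorm. *)
Definition linear_graph (G : set (V * R)) :=
  forall (a : R) u v r s, G (u, r) -> G (v, s) -> G (a *: u + v, a * r + s).

(** The value [a] at [v] must lie between all [r - p (u - v)] and all [p (u + v) - r]. Subadditivity
    makes these compatible, the supremum of the lower bounds works, and homogeneity passes from
    [t = 1] and [t = -1] to every [t]. *)
Lemma linear_graph_extend S p (G : set (V * R)) v : seminorm_on S p ->
  linear_graph G -> G (0, 0) -> (forall u r, G (u, r) -> S u /\ r <= p u) -> S v ->
  exists a, forall u r t, G (u, r) -> r + t * a <= p (u + t *: v).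
Proof.
move=> hp lG G0 Gp Sv.
have hS := seminorm_subspace hp.
have GZ (t : R) u r : G (u, r) -> G (t *: u, t * r).
  by move=> Gu; have := lG t _ _ _ _ Gu G0; rewrite !addr0.
have key u1 r1 u2 r2 : G (u1, r1) -> G (u2, r2) -> r1 - p (u1 - v) <= p (u2 + v) - r2.
  move=> G1 G2; rewrite lerBlDr addrAC lerBrDr.
  have /Gp[_ h] := lG 1 _ _ _ _ G1 G2; move: h; rewrite scale1r mul1r => /le_trans; apply.
  have -> : u1 + u2 = (u2 + v) + (u1 - v) by rewrite addrACA subrr addr0 addrC.
  by apply: (seminormD hp); [apply: subspaceD|apply: subspaceB] => //;
    [case: (Gp _ _ G2)|case: (Gp _ _ G1)].
pose E := [set y | exists u r, G (u, r) /\ y = r - p (u - v)].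
have E0 : E !=set0 by exists (0 - p (0 - v)); exists 0, 0.
have aub u r : G (u, r) -> sup E <= p (u + v) - r.
  by move=> Gu; apply: ge_sup => // _ [u1 [r1 [G1 ->]]]; apply: key.
have alb u r : G (u, r) -> r - p (u - v) <= sup E.
  move=> Gu; apply: ub_le_sup; last by exists u, r.
  by exists (p (0 + v) - 0) => _ [u1 [r1 [G1 ->]]]; apply: key.
exists (sup E) => u r t Gu; have Su := (Gp _ _ Gu).1.
have [t0|t0|->] := ltgtP t 0; last by rewrite mul0r scale0r !addr0; case: (Gp _ _ Gu).
- have := alb _ _ (GZ (- t)^-1 _ _ Gu).
  have -> : (- t)^-1 *: u - v = (- t)^-1 *: (u + t *: v).
    by rewrite scalerDr scalerA invrN mulNr mulVf ?lt_eqF // scaleN1r.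
  have nt0 : 0 < - t by rewrite oppr_gt0.
  rewrite (seminormZ hp); last by apply: subspaceD => //; apply: subspaceZ.
  rewrite gtr0_norm ?invr_gt0 // -mulrBr -(ler_pM2l nt0) mulrA mulfV ?gt_eqF // mul1r => h.
  lra.
- have := aub _ _ (GZ t^-1 _ _ Gu).
  have -> : t^-1 *: u + v = t^-1 *: (u + t *: v).
    by rewrite scalerDr scalerA mulVf ?gt_eqF // scale1r.
  rewrite (seminormZ hp); last by apply: subspaceD => //; apply: subspaceZ.
  rewrite gtr0_norm ?invr_gt0 // -mulrBr -(ler_pM2l t0) mulrA mulfV ?gt_eqF // mul1r => h.
  lra.
Qed.

Lemma hahn_banach_norming p x : seminorm_on setT p ->
  exists f : V -> R, [/\ linear_on setT f, (forall v, `|f v| <= p v) & f x = p x].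
Proof.
move=> hp.
(* The union of the empty chain is empty, so the norming pair is demanded of nonempty graphs only; a
   maximal graph is nonempty because [G0] satisfies [P]. *)
pose P (G : set (V * R)) := [/\ linear_graph G, forall u r, G (u, r) -> r <= p u &
  G !=set0 -> G (x, p x)].
pose G0 := [set (t *: x, t * p x) | t in [set: R]].
have lin_le0 (a : R) : (forall t, t * a <= 0) -> a = 0.
  move=> h; have := h 1; have := h (-1); lra.
have PG0 : P G0.
  split.
  - move=> a _ _ _ _ [t _ [<- <-]] [s _ [<- <-]]; exists (a * t + s) => //.
    by rewrite scalerDl scalerA mulrDl mulrA.
  - move=> _ _ [t _ [<- <-]]; rewrite (seminormZ hp) // ler_wpM2r ?ler_norm //.
    exact: seminorm_ge0 hp _ _.
  - by move=> _; exists 1 => //; rewrite scale1r mul1r.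
have [|G [[lG Gp Gx] Gmax]] := @Zorn_bigcup _ P.
  move=> F FP Ftot; split.
  - move=> a u v r s [A FA Au] [B FB Bv].
    have [AB|BA] := Ftot _ _ FA FB.
    + by exists B => //; have [+ _ _] := FP _ FB; apply => //; apply: AB.
    + by exists A => //; have [+ _ _] := FP _ FA; apply => //; apply: BA.
  - by move=> u r [A FA Au]; have [_ + _] := FP _ FA; apply.
  - by move=> [y [A FA Ay]]; exists A => //; have [_ _] := FP _ FA; apply; exists y.
have {}Gx : G (x, p x).
  apply: Gx; apply: contrapT => /nonemptyPn G_0; apply: (Gmax _ _ PG0); rewrite G_0.
  by split => [|/(_ (0 *: x, 0 * p x))]; [exact: sub0set|apply; exists 0].
have G00 : G (0, 0).
  have := lG (-1) _ _ _ _ Gx Gx.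
  by rewrite scaleN1r mulN1r !addNr.
have tot v : exists r, G (v, r).
  have [a ha] := linear_graph_extend (v := v) hp lG G00 (fun u r h => conj I (Gp u r h)) I.
  pose G' := [set w : V * R | exists u r t, G (u, r) /\ w = (u + t *: v, r + t * a)].
  have GG' : G `<=` G'.
    by move=> [u r] Gu; exists u, r, 0; rewrite scale0r mul0r !addr0.
  have PG' : P G'.
    split; last by move=> _; apply: GG'.
    - move=> b _ _ _ _ [u [r [t [Gu [-> ->]]]]] [u' [r' [t' [Gu' [-> ->]]]]].
      exists (b *: u + u'), (b * r + r'), (b * t + t'); split; first exact: lG.
      congr pair; last by ring.
      by rewrite scalerDr addrACA scalerA scalerDl.
    - by move=> _ _ [u [r [t [Gu [-> ->]]]]]; apply: ha.
  have G'v : G' (v, a) by exists 0, 0, 1; rewrite scale1r mul1r !add0r.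
  exists a; apply: contrapT => nG; apply: (Gmax G') => //.
  by split => // /(_ _ G'v).
have uniqG v r s : G (v, r) -> G (v, s) -> r = s.
  move=> Gr Gs; apply/eqP; rewrite -subr_eq0; apply/eqP; apply: lin_le0 => t.
  have := lG (-1) _ _ _ _ Gs Gr; rewrite scaleN1r mulN1r addNr => G0s.
  have := lG t _ _ _ _ G0s G00; rewrite scaler0 !addr0 => /Gp.
  by rewrite (seminorm0 hp) addrC.
pose f v := sval (cid (tot v)).
have fG v : G (v, f v) by rewrite /f; case: cid.
have lf : linear_on setT f.
  by move=> a u v _ _; apply: uniqG (fG _) _; apply: lG.
exists f; split => //.
- move=> v; rewrite ler_norml Gp // andbT lerNl -mulN1r -(linear_onZ _ _ lf) //.
  by rewrite -(seminormN hp (u := v)) // scaleN1r; apply: Gp.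
- exact: uniqG (fG _) Gx.
Qed.

(* A Helly-type extension: only finitely many one-dimensional extension steps are
   needed, so the correction is a combination of the [g i]. *)
Lemma dominated_mod_kernels S p (psi : V -> R) (g : nat -> V -> R) m :
  seminorm_on S p -> linear_on S psi -> (forall i, (i < m)%N -> linear_on S (g i)) ->
  (forall v, S v -> (forall i, (i < m)%N -> g i v = 0) -> `|psi v| <= p v) ->
  exists a : nat -> R, forall v, S v -> `|psi v - \sum_(i < m) a i * g i v| <= p v.
Proof.
elim: m S psi => [|m IH] S psi hp lpsi lg h.
  by exists (fun=> 0) => v Sv; rewrite big_ord0 subr0; apply: h.
(* The induction hypothesis is used on the kernel of the last functional [g m]; one extension step
   then recovers the missing direction [v1], where [g m] equals 1. *)
have hS := seminorm_subspace hp.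
have lgm := lg m (ltnSn m).
pose S' := [set v | S v /\ g m v = 0].
have hS' : subspace S'.
  split; first by split; [case: hS|apply: linear_on0 lgm].
  move=> a u v [Su gu] [Sv gv]; split; first by case: hS => _; apply.
  by rewrite lgm // gu gv mulr0 addr0.
have hp' : seminorm_on S' p by apply: seminorm_on_sub hp => // v [].
have [|i im||a ha] := IH S' psi hp'.
- by move=> a u v [Su _] [Sv _]; apply: lpsi.
- by move=> a u v [Su _] [Sv _]; apply: lg => //; apply: leqW.
- move=> v [Sv gv] hv; apply: h => // i; rewrite ltnS leq_eqVlt => /predU1P[->//|].
  exact: hv.
pose psi' v := psi v - \sum_(i < m) a i * g i v.
have lpsi' : linear_on S psi'.
  move=> b u v Su Sv; rewrite /psi' lpsi // mulrBr addrACA -opprD; congr (_ - _).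
  rewrite mulr_sumr -big_split; apply: eq_bigr => i _ /=.
  by rewrite (lg _ (leqW (ltn_ord i))) //; ring.
suff [b hb] : exists b, forall v, S v -> `|psi' v - b * g m v| <= p v.
  exists (fun i => if i == m then b else a i) => v Sv.
  rewrite big_ord_recr /= eqxx opprD addrA.
  have := hb v Sv; rewrite /psi'; congr (`| _ - _ - _| <= _).
  by apply: eq_bigr => i _; rewrite ltn_eqF.
have [[v0 Sv0 gv0]|ng] := pselect (exists2 v, S v & g m v != 0); last first.
  exists 0 => v Sv; rewrite mul0r subr0; apply: ha; split => //.
  by apply: contrapT => /eqP gv; apply: ng; exists v.
pose v1 := (g m v0)^-1 *: v0.
have Sv1 : S v1 by apply: subspaceZ.
have gv1 : g m v1 = 1 by rewrite (linear_onZ _ hS lgm) // mulVf.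
pose G := [set w : V * R | S' w.1 /\ w.2 = psi' w.1].
have [||||b hb] := linear_graph_extend (G := G) (v := v1) hp.
- move=> c u v r s [Su /= ->] [Sv /= ->]; split; first by case: hS' => _; apply.
  by rewrite /= lpsi' //; [case: Su|case: Sv].
- by split => /=; [case: hS'|rewrite (linear_on0 hS lpsi')].
- move=> u r [Su /= ->]; split; first by case: Su.
  exact: le_trans (ler_norm _) (ha _ Su).
- by [].
(* Here [b] is the value at [v1] of a dominated extension of [psi'] from the kernel. Writing [v] as
   a kernel vector plus [g m v *: v1] shows that this extension is [psi'] minus a multiple of
   [g m]. *)
have up v : S v -> psi' v - (psi' v1 - b) * g m v <= p v.
  move=> Sv; have Sgv : S (g m v *: v1) by apply: subspaceZ.
  have Gv : G (v - g m v *: v1, psi' (v - g m v *: v1)).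
    split => //=; split; first exact: subspaceB.
    by rewrite (linear_onB hS lgm) // (linear_onZ _ hS lgm) // gv1 mulr1 subrr.
  have := hb _ _ (g m v) Gv; rewrite subrK; apply: le_trans.
  rewrite (linear_onB hS lpsi') // (linear_onZ (g m v) hS lpsi' Sv1).
  by rewrite -[leRHS]addrA lerD2l mulrBl opprB addrC [b * _]mulrC (mulrC _ (g m v)).
exists (psi' v1 - b) => v Sv; rewrite ler_norml up // andbT.
have SNv : S ((-1) *: v) by apply: subspaceZ.
have := up _ SNv; rewrite (linear_onZ _ hS lpsi') // (linear_onZ _ hS lgm) //.
rewrite (seminormZ hp) // normrN1 mul1r lerNl => hv.
by apply: le_trans hv; rewrite !mulN1r mulrN opprB addrC opprK.
Qed.

End HahnBanach.

(** * James's construction in nonreflexive spaces *)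

(** Recursion in which each term depends on all earlier ones; iterating on the type of lists
    satisfying [P] keeps the invariant at hand. *)
Lemma seq_choice (T : Type) (P : seq T -> Prop) : P [::] ->
  (forall s, P s -> exists t, P (rcons s t)) ->
  exists u : nat -> T, forall n, P (mkseq u n).
Proof.
move=> P0 h.
have /choice[F hF] : forall s : {s | P s}, exists t, P (rcons (sval s) t).
  by move=> [s Ps]; apply: h.
pose st n := iter n (fun s : {s | P s} => exist P (rcons (sval s) (F s)) (hF s))
  (exist P [::] P0).
exists (fun n => F (st n)) => n.
suff -> : mkseq (fun n => F (st n)) n = sval (st n) by case: (st n).
elim: n => // n IH.
by rewrite /mkseq -addn1 iotaD map_cat /= -/(mkseq _ _) IH cats1 add0n addn1.
Qed.

Lemma Xnorm_seminorm (R : realType) (X : normedModType R) :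
  seminorm_on setT (@Xnorm R X).
Proof.
split=> [|u v _ _|a u _]; first by split.
  exact: ler_normD.
exact: normrZ.
Qed.

(** * The dual of a normed space and Helly-type lemmas *)

Section Dual.
Variables (R : realType) (X : normedModType R).
Implicit Types (f : X -> R).

Local Notation dual := (bdd_lin_fun setT (@Xnorm R X)).
Local Notation dnorm := (dual_norm setT (@Xnorm R X)).

Let sT : subspace [set: X]. Proof. by []. Qed.

Lemma dual_linear f : dual f -> linear_on setT f.
Proof. by case. Qed.

Let dual_ub f : dual f -> has_ubound [set r | exists v, setT v /\ Xnorm v <= 1 /\ r = `|f v|].
Proof.
move=> [_ [M hM]]; exists `|M| => _ [v [_ [v1 ->]]].
apply: le_trans (hM v I) _; apply: le_trans (ler_norm _) _.
by rewrite normrM ler_piMr // normr_id.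
Qed.

Lemma dual_norm_ge0 f : dual f -> 0 <= dnorm f.
Proof.
move=> df; apply: le_trans (normr_ge0 (f 0)) _; apply: ub_le_sup; first exact: dual_ub.
by exists 0; split => //; split => //; rewrite /Xnorm normr0.
Qed.

Lemma le_dual_norm f v : dual f -> `|f v| <= dnorm f * `|v|.
Proof.
move=> df; have lf := dual_linear df.
have [->|v0] := eqVneq v 0; first by rewrite (linear_on0 sT lf) !normr0 mulr0.
have nv : 0 < `|v| by rewrite normr_gt0.
rewrite -ler_pdivrMr // mulrC.
have -> : `|v|^-1 * `|f v| = `|f (`|v|^-1 *: v)|.
  by rewrite (linear_onZ _ sT lf) // normrM normfV normr_id.
apply: ub_le_sup; first exact: dual_ub.
exists (`|v|^-1 *: v); split => //; split => //.
by rewrite /Xnorm normrZ normfV normr_id mulVf ?gt_eqF.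
Qed.

Lemma dual_norm_le f (c : R) : 0 <= c -> (forall v, `|f v| <= c * `|v|) -> dnorm f <= c.
Proof.
move=> c0 h; apply: ge_sup.
  by exists `|f 0|; exists 0; split => //; split => //; rewrite /Xnorm normr0.
by move=> _ [v [_ [v1 ->]]]; apply: le_trans (h v) _; rewrite ler_piMr.
Qed.

Lemma dual_subspace : subspace dual.
Proof.
split.
  split; first by move=> a u v _ _; rewrite /= mulr0 addr0.
  by exists 0 => v _; rewrite mul0r normr0.
move=> a f g [lf [M hM]] [lg [K hK]]; split.
  move=> b u v Su Sv; have := lf b u v Su Sv; have := lg b u v Su Sv => hg hf.
  rewrite -[LHS]/(a * f (b *: u + v) + g (b *: u + v)) hf hg.
  by rewrite -[RHS]/(b * (a * f u + g u) + (a * f v + g v)); ring.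
exists (`|a| * M + K) => v Sv; rewrite mulrDl -mulrA.
apply: le_trans (ler_normD _ _) _; rewrite lerD ?hK //.
by rewrite normrM ler_wpM2l ?hM.
Qed.

Lemma dual_norm_seminorm : seminorm_on dual dnorm.
Proof.
apply: seminorm_on_of_le => [|f|f g df dg|a f df].
- exact: dual_subspace.
- exact: dual_norm_ge0.
- apply: dual_norm_le => [|v]; first by rewrite addr_ge0 ?dual_norm_ge0.
  by rewrite mulrDl (le_trans (ler_normD _ _)) // lerD ?le_dual_norm.
- apply: dual_norm_le => [|v]; first by rewrite mulr_ge0 ?dual_norm_ge0.
  by rewrite normrM -mulrA ler_wpM2l ?le_dual_norm.
Qed.

Definition dual_ball f := linear_on setT f /\ forall v, `|f v| <= `|v|.

Lemma dual_ball_dual f : dual_ball f -> dual f.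
Proof. by move=> [lf hf]; split => //; exists 1 => v _; rewrite mul1r; apply: hf. Qed.

Lemma dual_ball_norm f : dual_ball f -> dnorm f <= 1.
Proof. by move=> [_ hf]; apply: dual_norm_le => // v; rewrite mul1r. Qed.

Lemma dual_norm_ball f : dual f -> dnorm f <= 1 -> dual_ball f.
Proof.
move=> df f1; split; first exact: dual_linear.
by move=> v; apply: le_trans (le_dual_norm v df) _; rewrite ler_piMl.
Qed.

Lemma le_norm_dual_ball x (r : R) : (forall f, dual_ball f -> `|f x| <= r) -> `|x| <= r.
Proof.
move=> h; have [f [lf fN fx]] := hahn_banach_norming x (Xnorm_seminorm X).
by have := h f (conj lf fN); rewrite fx /Xnorm normr_id.
Qed.

Variable psi : (X -> R) -> R.
Hypothesis lpsi : linear_on dual psi.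

(** Without such an [x], the norm dominates [th^-1 *: f 0] on the common kernel of the differences
    [f i - f 0], since a violating vector could be rescaled to a solution. Correcting by these
    differences, which [psi] kills, gives [g] in the dual ball with [psi g = 1 > rho]. *)
Lemma helly_vector (th rho : R) (f : nat -> X -> R) m : 0 < th -> rho < 1 ->
  (forall g, dual_ball g -> `|psi g| <= rho) ->
  (forall i, (i < m)%N -> dual (f i) /\ psi (f i) = th) ->
  exists2 x, `|x| <= 1 & forall i, (i < m)%N -> f i x = th.
Proof.
move=> th0 rho1 psiB hf; case: m hf => [|m] hf; first by exists 0; rewrite ?normr0.
apply: contrapT => nx.
have df i : (i < m.+1)%N -> dual (f i) by move=> /hf[].
have lf i im := dual_linear (df i im).
have thN : th != 0 by rewrite gt_eqF.
pose h i := f i - f 0%N.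
have dh i : (i < m.+1)%N -> dual (h i).
  by move=> im; apply: (subspaceB dual_subspace); apply: df.
have df0 : dual (th^-1 *: f 0%N) by apply: (subspaceZ _ dual_subspace); apply: df.
have [||v _ hv|a ha] := @dominated_mod_kernels _ _ setT (@Xnorm R X)
  (th^-1 *: f 0%N) h m.+1 (Xnorm_seminorm X).
- exact: dual_linear.
- by move=> i im; apply: dual_linear; apply: dh.
- rewrite leNgt; apply/negP; rewrite -[(_ *: _) v]/(th^-1 * f 0%N v) => vlt; apply: nx.
  have v0 : f 0%N v != 0.
    by apply: contraTneq vlt; move=> ->; rewrite mulr0 normr0 -leNgt normr_ge0.
  exists ((th / f 0%N v) *: v).
    rewrite normrZ; apply: ltW; rewrite normrM mulrC mulrA -ltr_pdivlMr.
      rewrite normfV invrK mul1r; move: vlt; rewrite normrM normfV => vlt.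
      by rewrite mulrC -ltr_pdivlMl ?normr_gt0.
    by rewrite normfV invr_gt0 normr_gt0.
  move=> i im; rewrite (linear_onZ _ sT (lf i im)) //.
  have := hv i im; rewrite /h /= => /eqP; rewrite subr_eq0 => /eqP ->.
  by rewrite mulfVK.
pose g := th^-1 *: f 0%N - \sum_(i < m.+1) a i *: h i.
have Sah (i : nat) : (i < m.+1)%N -> dual (a i *: h i).
  by move=> im; apply: (subspaceZ _ dual_subspace); apply: dh.
have [Ssum psum] : dual (\sum_(i < m.+1) a i *: h i) /\
    psi (\sum_(i < m.+1) a i *: h i) = 0.
  have : forall i, (i < m.+1)%N -> dual (a i *: h i) /\ psi (a i *: h i) = 0.
    move=> i im; split; first exact: Sah.
    rewrite (linear_onZ _ dual_subspace lpsi) ?(linear_onB dual_subspace lpsi) //.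
    - by rewrite (hf i im).2 (hf 0%N _).2 // subrr mulr0.
    - exact: df.
    - exact: df.
    - exact: dh.
  elim: (m.+1) => [|k IH] hk; first by rewrite big_ord0 (linear_on0 dual_subspace lpsi);
    split => //; case: dual_subspace.
  have [d1 p1] := IH (fun i ik => hk i (leqW ik)).
  have [d2 p2] := hk k (ltnSn k).
  rewrite big_ord_recr /= (linear_onD dual_subspace lpsi) // p1 p2 addr0.
  by split => //; apply: subspaceD dual_subspace _ _.
have dg : dual g by apply: (subspaceB dual_subspace).
have gB : dual_ball g.
  split; first exact: dual_linear.
  move=> v; have := ha v I; congr (_ <= _); congr `|_|; rewrite /g /=; congr (_ - _).
  by rewrite fct_sumE.
have := psiB g gB.
rewrite (linear_onB dual_subspace lpsi) // psum subr0 (linear_onZ _ dual_subspace lpsi).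
  by rewrite (hf 0%N _).2 // mulVf // normr1 leNgt rho1.
exact: df.
Qed.

(** The same argument one level up. Without such an [f], [psi] is dominated by [th] times the dual
    norm on the functionals vanishing at all [x i]; the correction is evaluation at a combination
    [y] of the [x i], so [psi] lies within [th < d] of [y]. *)
Lemma helly_functional (th d : R) (x : nat -> X) m : 0 < th -> th < d ->
  (forall y (e : R), 0 < e -> exists2 g, dual_ball g & d - e <= `|psi g - g y|) ->
  exists f, [/\ dual_ball f, psi f = th & forall i, (i < m)%N -> f (x i) = 0].
Proof.
move=> th0 thd far; apply: contrapT => nf.
pose p f := th * dnorm f.
have hp : seminorm_on dual p.
  split=> [|f g df dg|a f df]; first exact: dual_subspace.
    by rewrite /p -mulrDr ler_wpM2l ?(ltW th0) // (seminormD dual_norm_seminorm).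
  by rewrite /p (seminormZ dual_norm_seminorm) // mulrCA.
have [|f df fx|a ha] := @dominated_mod_kernels _ _ dual p psi (fun i f => f (x i)) m hp lpsi.
- by move=> i _ a f g _ _.
- rewrite leNgt; apply/negP => lt; apply: nf.
  have psi0 : psi f != 0.
    by apply: contraTneq lt => ->; rewrite normr0 -leNgt mulr_ge0 ?dual_norm_ge0 // ltW.
  exists ((th / psi f) *: f); split.
  + apply: dual_norm_ball; first exact: subspaceZ dual_subspace _.
    rewrite (seminormZ dual_norm_seminorm) // normrM normfV (gtr0_norm th0) mulrAC.
    by rewrite ler_pdivrMr ?normr_gt0 // mul1r ltW.
  + by rewrite (linear_onZ _ dual_subspace lpsi) // mulfVK.
  + by move=> i im; rewrite -[LHS]/(th / psi f * f (x i)) fx // mulr0.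
pose y := \sum_(i < m) a i *: x i.
have e0 : 0 < (d - th) / 2 by rewrite divr_gt0 // subr_gt0.
have [g gB] := far y _ e0.
have dg := dual_ball_dual gB.
have := ha g dg.
have -> : \sum_(i < m) a i * g (x i) = g y.
  rewrite (linear_on_sum (x := fun i => a i *: x i) m sT (dual_linear dg)) //.
  by apply: eq_bigr => i _; rewrite (linear_onZ _ sT (dual_linear dg)).
have : p g <= th by rewrite /p ler_piMr ?dual_ball_norm // ltW.
lra.
Qed.

End Dual.

Section James.
Variables (R : realType) (X : completeNormedModType R).

Local Notation dual := (bdd_lin_fun setT (@Xnorm R X)).
Local Notation dnorm := (dual_norm setT (@Xnorm R X)).

Let sT : subspace [set: X]. Proof. by []. Qed.

(* Riesz's lemma for [X] inside its bidual. *)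
Lemma nonreflexive_almost_orthogonal (th : R) : 0 < th -> th < 1 -> ~ @reflexive_space R X ->
  exists (psi : (X -> R) -> R) (rho d : R), [/\ linear_on dual psi, rho < 1, th < d,
    (forall g, dual_ball g -> `|psi g| <= rho) &
    (forall y (e : R), 0 < e -> exists2 g, dual_ball g & d - e <= `|psi g - g y|)].
Proof.
move=> th0 th1 nR.
have [phi [lphi [M hM]] nphi] : exists2 phi : (X -> R) -> R,
    linear_on dual phi /\ (exists M : R, forall f, dual f -> `|phi f| <= M * dnorm f) &
    ~ exists x, forall f, dual f -> phi f = f x.
  apply: contrapT => h; apply: nR => phi lphi bphi.
  apply: contrapT => nphi; apply: h; exists phi; first by split.
  by move=> [x hx]; apply: nphi; exists x.
pose E y := [set `|phi g - g y| | g in @dual_ball R X].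
(* The bidual distance from [phi] to evaluation at [y]. *)
pose D y := sup (E y).
have B0 : dual_ball (fun=> 0 : R) (X := X).
  by split=> [a u v _ _|v]; rewrite ?mulr0 ?addr0 ?normr0.
have E0 y : E y !=set0 by exists `|phi (fun=> 0) - 0|; exists (fun=> 0).
have Eub y : has_ubound (E y).
  exists (`|M| + `|y|) => _ [g gB <-]; apply: le_trans (ler_normB _ _) _.
  apply: lerD; last by case: gB.
  apply: le_trans (hM g (dual_ball_dual gB)) _; apply: le_trans (ler_norm _) _.
  rewrite normrM ler_piMr // ger0_norm ?dual_ball_norm //.
  exact: dual_norm_ge0 (dual_ball_dual gB).
have leD y g : dual_ball g -> `|phi g - g y| <= D y.
  by move=> gB; apply: ub_le_sup => //; exists g.
have D0 y : 0 <= D y by apply: le_trans (normr_ge0 _) (leD y _ B0).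
pose d := inf (range D).
have dlb : has_lbound (range D) by exists 0 => _ [y _ <-].
have Dinf : range D !=set0 by exists (D 0); exists 0.
have ledD y : d <= D y by apply: ge_inf => //; exists y.
(* At distance 0, points with [D (x n)] tending to 0 form a Cauchy sequence, as the norm of
   [x n - x m] is at most [D (x n) + D (x m)]; by completeness its limit would represent [phi]. *)
have d0 : 0 < d.
  rewrite lt0r; apply/andP; split; last by apply: lb_le_inf => // _ [y _ <-].
  apply/negP => /eqP dE; apply: nphi.
  have /choice[x hx] : forall n, exists x, D x < n.+1%:R^-1.
    move=> n; have : inf (range D) < n.+1%:R^-1 by rewrite -/d dE invr_gt0 ltr0n.
    by move=> /(inf_lt Dinf) [_ [x _ <-] ?]; exists x.
  have cx : cvg (x @ \oo).
    apply: cauchy_cvg; apply/cauchy_exP => e e0.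
    pose n := Num.truncn (2 / e); exists (x n); exists n => // m /= nm.
    have small k : (n <= k)%N -> D (x k) < e / 2.
      move=> nk; apply: lt_le_trans (hx k) _.
      rewrite -[leRHS]invrK lef_pV2 ?posrE ?invr_gt0 ?divr_gt0 //.
      rewrite invf_div; apply: le_trans (ltW (truncnS_gt _)) _.
      by rewrite ler_nat ltnS.
    rewrite -ball_normE /ball_ /=; apply: le_lt_trans (_ : D (x n) + D (x m) < e); last first.
      by have := small n (leqnn n); have := small m nm; lra.
    apply: le_norm_dual_ball => f fB.
    rewrite (linear_onB sT fB.1) //.
    have -> : f (x n) - f (x m) = (phi f - f (x m)) - (phi f - f (x n)) by ring.
    by rewrite [leRHS]addrC (le_trans (ler_normB _ _)) // lerD ?leD.
  exists (lim (x @ \oo)).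
  have ball_case g : dual_ball g -> phi g = g (lim (x @ \oo)).
    move=> gB; apply/eqP; rewrite -subr_eq0 -normr_le0; apply/ler_addgt0Pr => e e0.
    rewrite add0r.
    have : \forall n \near \oo, `|lim (x @ \oo) - x n| < e / 2 /\ n.+1%:R^-1 < e / 2.
      near=> n; split.
        near: n; have /cvgrPdist_lt := cx; apply; exact: divr_gt0.
      by near: n; apply: near_infty_natSinv_lt (PosNum (divr_gt0 e0 (ltr0n _ 2))).
    move=> [n _ /(_ n (leqnn n)) [h1 h2]].
    have h3 := leD (x n) g gB; have h4 := hx n.
    have -> : phi g - g (lim (x @ \oo)) = (phi g - g (x n)) - g (lim (x @ \oo) - x n).
      by rewrite (linear_onB sT gB.1) //; ring.
    apply: le_trans (ler_normB _ _) _.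
    rewrite [e]splitr lerD //; last exact: le_trans (gB.2 _) (ltW h1).
    exact: le_trans h3 (ltW (lt_trans h4 h2)).
  move=> f df; pose c := dnorm f + 1.
  have c0 : 0 < c by rewrite ltr_wpDl ?dual_norm_ge0.
  have := ball_case (c^-1 *: f) _.
  rewrite (linear_onZ _ (dual_subspace X) lphi) // => h.
  apply: (mulfI (lt0r_neq0 (_ : 0 < c^-1))); first by rewrite invr_gt0.
  apply: h; apply: dual_norm_ball; first exact: subspaceZ (dual_subspace X) _.
  rewrite (seminormZ (dual_norm_seminorm X)) // gtr0_norm ?invr_gt0 //.
  by rewrite ler_pdivrMl // mulr1 /c lerDl.
(* With [th < ka < ka' < 1] and [D x0 < d / ka'], the functional [(ka / d) (phi - x0)] has norm at
   most [ka / ka' < 1] and distance at least [ka > th] to [X]. *)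
pose ka := (1 + th) / 2; pose ka' := (1 + ka) / 2.
have thka : th < ka by rewrite /ka; lra.
have ka0 : 0 < ka by lra.
have ka1 : ka < 1 by rewrite /ka; lra.
have kaka' : ka < ka' by rewrite /ka'; lra.
have ka'0 : 0 < ka' by lra.
have ka'1 : ka' < 1 by rewrite /ka'; lra.
have [x0 hx0] : exists x0, D x0 < d / ka'.
  have : inf (range D) < d / ka' by rewrite -/d ltr_pdivlMr // gtr_pMr.
  by move=> /(inf_lt Dinf) [_ [x _ <-] ?]; exists x.
pose c := ka / d; have c0 : 0 < c by rewrite divr_gt0.
exists (fun f => c * (phi f - f x0)), (ka / ka'), ka; split => //.
- by move=> a f g df dg; rewrite lphi // -[(a *: f + g) x0]/(a * f x0 + g x0); ring.
- by rewrite ltr_pdivrMr // mul1r.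
- move=> g gB; rewrite normrM gtr0_norm //.
  apply: le_trans (ler_wpM2l (ltW c0) (leD x0 g gB)) _.
  apply: le_trans (ler_wpM2l (ltW c0) (ltW hx0)) _.
  by rewrite /c mulrA mulfVK ?gt_eqF.
- move=> y e e0; have ec0 : 0 < e / c by rewrite divr_gt0.
  have [_ [g gB <-] hg] :=
    sup_adherent ec0 (conj (E0 (x0 + c^-1 *: y)) (Eub (x0 + c^-1 *: y))).
  exists g => //; have dg := dual_linear (dual_ball_dual gB).
  have -> : c * (phi g - g x0) - g y = c * (phi g - g (x0 + c^-1 *: y)).
    rewrite (linear_onD sT dg) // (linear_onZ _ sT dg) // opprD addrA [in RHS]mulrBr.
    by rewrite mulrA mulfV ?gt_eqF // mul1r.
  rewrite normrM gtr0_norm //; rewrite -ler_pdivrMl //; apply: le_trans (ltW hg).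
  have -> : c^-1 * (ka - e) = d - e / c.
    by rewrite mulrBr [c^-1 * e]mulrC; congr (_ - _); rewrite /c invf_div mulfVK ?gt_eqF.
  by rewrite lerD2r ledD.
Unshelve. all: by end_near.
Qed.

(** Each step first picks a functional vanishing on the earlier vectors, then a vector on which all
    functionals so far, the new one included, equal [th]. The invariant also records [psi f = th],
    which the choice of the next vector requires. *)
Lemma james_sequence (th : R) : 0 < th -> th < 1 -> ~ @reflexive_space R X ->
  exists (f : nat -> X -> R) (x : nat -> X),
    [/\ forall i, dual_ball (f i), forall j, `|x j| <= 1 &
      forall i j, f i (x j) = if (i <= j)%N then th else 0].
Proof.
move=> th0 th1 nR.
have [psi [rho [d [lpsi rho1 thd psiB far]]]] := nonreflexive_almost_orthogonal th0 th1 nR.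
pose z : (X -> R) * X := (fun=> 0, 0).
pose P (s : seq ((X -> R) * X)) := forall i j, (i < size s)%N -> (j < size s)%N ->
  [/\ dual_ball (nth z s i).1, psi (nth z s i).1 = th, `|(nth z s j).2| <= 1 &
      (nth z s i).1 (nth z s j).2 = if (i <= j)%N then th else 0].
have [//|s Ps|u hu] := @seq_choice _ P.
- have [f [fB pf fx]] := helly_functional lpsi (fun i => (nth z s i).2) (size s) th0 thd far.
  pose F i := if (i < size s)%N then (nth z s i).1 else f.
  have [i im|x x1 hx] := helly_vector lpsi (f := F) (m := (size s).+1) th0 rho1 psiB.
    rewrite /F; case: ltnP => [is_|_]; last by split => //; apply: dual_ball_dual.
    by have [/dual_ball_dual] := Ps i i is_ is_.
  exists (f, x) => i j; rewrite size_rcons !ltnS !nth_rcons => ii jj.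
  have Hx : (if (i < size s)%N then nth z s i else if i == size s then (f, x) else z).1 x = th.
    have := hx i; rewrite ltnS => /(_ ii); rewrite /F.
    by move: ii; case: ltngtP.
  split.
  + by case: ltngtP ii => // is_ _; have [] := Ps i i is_ is_.
  + by case: ltngtP ii => // is_ _; have [] := Ps i i is_ is_.
  + by case: ltngtP jj => // js _; have [] := Ps j j js js.
  + case: (ltngtP j) jj Hx => // [js _ _|-> _ ->]; last by rewrite ii.
    case: (ltngtP i) ii => // [is_ _|-> _]; first by have [] := Ps i j is_ js.
    by rewrite /= fx // leqNgt js.
exists (fun i => (u i).1), (fun i => (u i).2).
have h i j : [/\ dual_ball (u i).1, psi (u i).1 = th, `|(u j).2| <= 1 &
      (u i).1 (u j).2 = if (i <= j)%N then th else 0].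
  have iij : (i < (maxn i j).+1)%N by rewrite ltnS leq_maxl.
  have jij : (j < (maxn i j).+1)%N by rewrite ltnS leq_maxr.
  by have := hu (maxn i j).+1 i j; rewrite size_mkseq !nth_mkseq //; apply.
by split=> [i|j|i j]; [case: (h i 0%N)|case: (h 0%N j)|case: (h i j)].
Qed.

Lemma nonreflexive_bs_ge1 : ~ @reflexive_space R X ->
  1 <= bs (@Xnorm R X) (@unit_ball R X).
Proof.
move=> nR; apply/ler_addgt0Pr => e e0; rewrite -lerBlDr.
(* The maximum with 1/2 keeps [th] positive when [e] is large. *)
pose th := Num.max (1 - e) (1 / 2).
have th0 : 0 < th by rewrite lt_max divr_gt0 ?orbT.
have th1 : th < 1 by rewrite gt_max; apply/andP; split; lra.
apply: le_trans (_ : 1 - e <= th) _; first by rewrite le_max lexx.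
have [f [x [fB xB fx]]] := james_sequence th0 th1 nR.
rewrite -[th]subr0.
apply: (@le_bs_of_functionals _ _ setT _ (Xnorm_seminorm X) _ _ x); rewrite ?ltW //.
- by move=> v; split => [|[]].
- move=> n m; exists (f n); split; [by case: (fB n)|by move=> v _; apply: (fB n).2|].
  by move=> j _; apply: fx.
Qed.
End James.

(** * The spaces [c_0] and [c] *)

Lemma iter_choice (T : Type) (Q : T -> T -> Prop) (t0 : T) :
  (forall t, exists t', Q t t') ->
  exists u : nat -> T, u 0%N = t0 /\ forall n, Q (u n) (u n.+1).
Proof. by move=> /choice[F hF]; exists (fun n => iter n F t0); split => // n /=. Qed.

Section SupNorm.
Variable R : realType.
Implicit Types (a b : nat -> R) (x : nat -> nat -> R) (phi : nat -> nat).

Lemma supnorm_ge a i : c_set a -> `|a i| <= supnorm a.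
Proof.
move=> [l al]; apply: ub_le_sup; last by exists i.
have /cvg_seq_bounded/pinfty_ex_gt0[M M_gt0 /= aM] : cvg (a @ \oo) by apply/cvg_ex; exists l.
by exists M => _ [n _ <-]; apply: aM.
Qed.

Lemma supnorm_le a (r : R) : (forall i, `|a i| <= r) -> supnorm a <= r.
Proof.
move=> ar; apply: ge_sup; first by exists `|a 0%N|; exists 0%N.
by move=> _ [i _ <-].
Qed.

Lemma c_subspace : subspace (@c_set R).
Proof.
split; first by exists 0; apply: cvg_cst.
by move=> r u v [l ul] [m vm]; exists (r *: l + m); apply: cvgD => //; apply: cvgZr.
Qed.

Lemma c0_subspace : subspace (@c0_set R).
Proof.
split; first exact: cvg_cst.
move=> r u v u0 v0; rewrite /c0_set /= -(addr0 0) -{1}(scaler0 _ r).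
by apply: cvgD => //; apply: cvgZr.
Qed.

Lemma c0_sub_c : @c0_set R `<=` @c_set R.
Proof. by move=> a a0; exists 0. Qed.

Lemma supnorm_c_seminorm : seminorm_on (@c_set R) (@supnorm R).
Proof.
apply: seminorm_on_of_le => [|u cu|u v cu cv|r u cu]; first exact: c_subspace.
- exact: le_trans (normr_ge0 _) (supnorm_ge 0 cu).
- apply: supnorm_le => i; apply: le_trans (ler_normD _ _) _.
  by rewrite lerD ?supnorm_ge.
- by apply: supnorm_le => i; rewrite normrM ler_wpM2l ?supnorm_ge.
Qed.

Lemma supnorm_c0_seminorm : seminorm_on (@c0_set R) (@supnorm R).
Proof. by apply: seminorm_on_sub supnorm_c_seminorm; [exact: c0_sub_c|exact: c0_subspace]. Qed.

Lemma c_coord_bdd i : bdd_lin_fun (@c_set R) (@supnorm R) (fun a => a i).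
Proof. by split => //; exists 1 => a ca; rewrite mul1r supnorm_ge. Qed.

(** Coordinates alone do not control tails in c; testing weak convergence on this functional gives
    convergence of the limits. *)
Lemma c_lim_bdd : bdd_lin_fun (@c_set R) (@supnorm R) (fun a => lim (a @ \oo)).
Proof.
have cvgc a : c_set a -> cvg (a @ \oo) by move=> [l al]; apply/cvg_ex; exists l.
split=> [r u v /cvgc cu /cvgc cv|].
  by apply/cvg_lim => //; apply: cvgD => //; apply: cvgZr.
exists 1 => a ca; rewrite mul1r ler_norml; apply/andP; split.
  apply: limr_ge; first exact: cvgc.
  by apply: nearW => i; have := supnorm_ge i ca; rewrite ler_norml => /andP[].
apply: limr_le; first exact: cvgc.
by apply: nearW => i; have := supnorm_ge i ca; rewrite ler_norml => /andP[].
Qed.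

Lemma cesaro_coord x k i : cesaro x k i = (k.+1%:R)^-1 * \sum_(j < k.+1) x j i.
Proof. by rewrite /cesaro -[LHS]/(_ * (\sum_(j < k.+1) x j) i) fct_sumE. Qed.

(* For each coordinate [i], at most one of the [u k] (the first with [i < L k]) is
   close to neither [a] nor [b]. *)
Lemma average_two_values (u : nat -> R) (L : nat -> nat) i (a b e : R) m :
  (forall k, (L k <= L k.+1)%N) -> `|a| <= 1 -> 0 <= e -> (forall k, `|u k| <= 1) ->
  (forall k, (L k <= i)%N -> `|u k - a| <= e) ->
  (forall k, (i < L k)%N -> `|u k.+1 - b| <= e) ->
  exists2 t : R, 0 <= t <= 1 &
    `|(m.+1%:R)^-1 * \sum_(j < m.+1) u j - (b + t * (a - b))| <= e + 2 / m.+1%:R.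
Proof.
move=> Lm a1 e0 u1 ua ub.
have uma k : `|u k - a| <= 2.
  by apply: le_trans (ler_normB _ _) _; have := u1 k; lra.
(* Take [t = p / (m + 1)]. The exceptional term is counted as a copy of [a], at a cost of at most
   2. *)
suff [p [q [pq h]]] : exists p q : nat, (p + q = m.+1)%N /\
    `|\sum_(j < m.+1) u j - (p%:R * a + q%:R * b)| <= m.+1%:R * e + 2.
  have m0 : 0 < m.+1%:R :> R by rewrite ltr0n.
  have pqR : m.+1%:R = p%:R + q%:R :> R by rewrite -pq natrD.
  exists (p%:R / m.+1%:R).
    rewrite divr_ge0 ?ler0n //= ler_pdivrMr // mul1r ler_nat -pq; exact: leq_addr.
  have -> : (m.+1%:R)^-1 * \sum_(j < m.+1) u j - (b + p%:R / m.+1%:R * (a - b)) =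
      (m.+1%:R)^-1 * (\sum_(j < m.+1) u j - (p%:R * a + q%:R * b)).
    have -> : q%:R = m.+1%:R - p%:R :> R by rewrite pqR addrAC subrr add0r.
    move: (lt0r_neq0 m0).
    by move: (m.+1%:R) (\sum_(j < m.+1) u j) (p%:R) => M s P M0; field.
  rewrite normrM gtr0_norm ?invr_gt0 // ler_pdivrMl // mulrDr.
  by rewrite [_ * (2 / _)]mulrC mulfVK ?gt_eqF.
(* The induction remembers whether the switch has occurred, so that the cost 2 is paid only once. *)
suff : ((forall j, (j < m.+1)%N -> (L j <= i)%N) /\
     `|\sum_(j < m.+1) u j - m.+1%:R * a| <= m.+1%:R * e) \/
   ((i < L m)%N /\ exists p q : nat, (p + q = m.+1)%N /\
    `|\sum_(j < m.+1) u j - (p%:R * a + q%:R * b)| <= m.+1%:R * e + 2).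
  move=> [[_ h]|[_ //]]; exists m.+1, 0%N; rewrite addn0; split => //.
  by rewrite mul0r addr0 (le_trans h) // lerDl.
elim: m => [|m [[hL h]|[hL [p [q [pq h]]]]]].
- rewrite big_ord_recr big_ord0 /= add0r.
  have [L0|L0] := leqP (L 0%N) i; [left|right].
    by split => [[]//|]; rewrite !mul1r; apply: ua.
  split => //; exists 1%N, 0%N; split => //.
  by rewrite !mul1r mul0r addr0; have := uma 0%N; lra.
- have sE : \sum_(j < m.+2) u j - m.+2%:R * a =
      (\sum_(j < m.+1) u j - m.+1%:R * a) + (u m.+1 - a).
    rewrite big_ord_recr /= -[m.+2]addn1 natrD; ring.
  have mE : m.+2%:R = m.+1%:R + 1 :> R by rewrite natr1.
  have [L1|L1] := leqP (L m.+1) i; [left|right].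
    split=> [j|]; first by rewrite ltnS leq_eqVlt => /predU1P[->//|]; apply: hL.
    by rewrite sE mE mulrDl mul1r (le_trans (ler_normD _ _)) // lerD // ua.
  split=> //; exists m.+2, 0%N; rewrite addn0; split => //.
  rewrite mul0r addr0 sE mE mulrDl mul1r (le_trans (ler_normD _ _)) //.
  by apply: lerD; [rewrite (le_trans h) // lerDl|exact: uma].
- right; split; first exact: leq_trans (Lm m).
  exists p, q.+1; split; first by rewrite addnS pq.
  have -> : \sum_(j < m.+2) u j - (p%:R * a + q.+1%:R * b) =
      (\sum_(j < m.+1) u j - (p%:R * a + q%:R * b)) + (u m.+1 - b).
    rewrite big_ord_recr /= -[q.+1]addn1 natrD; ring.
  have -> : m.+2%:R = m.+1%:R + 1 :> R by rewrite natr1.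
  apply: le_trans (ler_normD _ _) _; have := ub m hL; rewrite mulrDl mul1r; lra.
Qed.

(** Each chosen term is near [b] before the previous cutoff and near [a] after its own. A fixed
    coordinate thus sees first [a i], then at most one free term, then [b i], and late Cesaro means
    lie near a segment of length at most [D]. *)
Lemma gliding_hump_cca x a b (D e : R) : 0 < e ->
  (forall n, c_set (x n)) -> (forall n i, `|x n i| <= 1) -> (forall i, `|a i| <= 1) ->
  (forall i, `|a i - b i| <= D) ->
  (forall n M, exists n' M', [/\ (n < n')%N, (M <= M')%N,
     forall i, (i < M)%N -> `|x n' i - b i| <= e &
     forall i, (M' <= i)%N -> `|x n' i - a i| <= e]) ->
  exists2 phi, (forall n, (phi n < phi n.+1)%N) & cca (@supnorm R) (x \o phi) <= D + 3 * e.
Proof.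
move=> e0 cx x1 a1 abD step.
pose Q (s t : nat * nat) := [/\ (s.1 < t.1)%N, (s.2 <= t.2)%N,
     forall i, (i < s.2)%N -> `|x t.1 i - b i| <= e &
     forall i, (t.2 <= i)%N -> `|x t.1 i - a i| <= e].
have [|u [_ hu]] := @iter_choice _ Q (0%N, 0%N).
  by move=> [n M]; have [n' [M' h]] := step n M; exists (n', M').
pose phi n := (u n.+1).1; pose L n := (u n.+1).2.
exists phi; first by move=> n; case: (hu n.+1).
(* From [n0] on, [2 / (k + 1) <= e / 2], so the two means together contribute an error of
   [3 * e]. *)
pose n0 := Num.truncn (4 / e).
have n0P k : (n0 <= k)%N -> 2 / k.+1%:R <= e / 2.
  move=> nk; have : 4 / e <= k.+1%:R.
    by apply: le_trans (ltW (truncnS_gt _)) _; rewrite ler_nat ltnS.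
  rewrite ler_pdivrMr // => h; rewrite ler_pdivrMr ?ltr0n //; lra.
have cc k : c_set (cesaro (x \o phi) k).
  by apply: (@subspace_cesaro _ _ _ _ supnorm_c_seminorm (x \o phi) k) => n /=; apply: cx.
apply: (@ca_le _ _ _ _ supnorm_c_seminorm _ _ n0) => // k l nk nl.
apply: supnorm_le => i.
have avg m : exists2 t : R, 0 <= t <= 1 &
    `|cesaro (x \o phi) m i - (b i + t * (a i - b i))| <= e + 2 / m.+1%:R.
  rewrite cesaro_coord; apply: (@average_two_values (fun j => x (phi j) i) L i) => //.
  - by move=> j; case: (hu j.+1).
  - exact: ltW.
  - by move=> j Lj; case: (hu j) => _ _ _; apply.
  - by move=> j Lj; case: (hu j.+1) => _ _ + _; apply.
have [t t01 ht] := avg k; have [s s01 hs] := avg l.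
have hk := n0P k nk; have hl := n0P l nl.
have ts : `|(t - s) * (a i - b i)| <= D.
  rewrite normrM; apply: le_trans (abD i).
  by rewrite ler_piMl // ler_norml; apply/andP; split; lra.
rewrite -[X in `|X|]/(cesaro (x \o phi) k i - cesaro (x \o phi) l i).
move: (cesaro _ k i) (cesaro _ l i) ht hs => A B ht hs.
have -> : A - B = (A - (b i + t * (a i - b i))) - (B - (b i + s * (a i - b i)))
    + (t - s) * (a i - b i) by ring.
have aux (P T W p q : R) : `|P| <= e + p -> `|T| <= e + q -> `|W| <= D ->
    p <= e / 2 -> q <= e / 2 -> `|P - T + W| <= D + 3 * e.
  by move: (ler_normD (P - T) W) (ler_normB P T); lra.
exact: aux ht hs ts hk hl.
Qed.

Let c_ballE v : @c_ball R v <-> c_set v /\ supnorm v <= 1. Proof. by []. Qed.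
Let c0_ballE v : @c0_ball R v <-> c0_set v /\ supnorm v <= 1. Proof. by []. Qed.

Let ball_coord (v : nat -> R) i : c_set v -> supnorm v <= 1 -> `|v i| <= 1.
Proof. by move=> cv; apply: le_trans (supnorm_ge i cv). Qed.

Lemma near_le_coords x b (e : R) : 0 < e -> (forall i, (fun n => x n i) @ \oo --> b i) ->
  forall M, \forall n \near \oo, forall i, (i < M)%N -> `|x n i - b i| <= e.
Proof.
move=> e0 xb; elim=> [|M IH]; first exact: nearW.
have /cvgrPdist_le/(_ e e0) := xb M => hM; near=> n => i.
rewrite ltnS leq_eqVlt => /predU1P[->|iM].
  by rewrite distrC; near: n.
by move: i iM; near: n.
Unshelve. all: by end_near.
Qed.

(** The gliding hump with [a = b = y] and [D = 0]. Far out, [x n] and [y] are both near their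
    limits, which are close to each other: three errors [e / 9] give the tolerance [e / 3]. *)
Lemma coordwise_cvg_cca x y (e : R) : 0 < e -> (forall n, c_ball (x n)) -> c_set y ->
  (forall i, (fun n => x n i) @ \oo --> y i) ->
  (fun n => lim (x n @ \oo)) @ \oo --> lim (y @ \oo) ->
  exists2 phi, (forall n, (phi n < phi n.+1)%N) & cca (@supnorm R) (x \o phi) <= e.
Proof.
move=> e0 Bx cy xy limxy.
have x1 n i : `|x n i| <= 1 by case: (Bx n) => ? ?; apply: ball_coord.
have e3 : 0 < e / 3 by rewrite divr_gt0.
have e9 : 0 < e / 9 by rewrite divr_gt0.
have y1 i : `|y i| <= 1.
  rewrite -(cvg_lim _ (xy i)) // ler_norml; apply/andP; split.
    apply: limr_ge; first by apply/cvg_ex; exists (y i); apply: xy.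
    by apply: nearW => n; have := x1 n i; rewrite ler_norml => /andP[].
  apply: limr_le; first by apply/cvg_ex; exists (y i); apply: xy.
  by apply: nearW => n; have := x1 n i; rewrite ler_norml => /andP[].
have [|n|n M|phi iphi h] := @gliding_hump_cca x y y 0 (e / 3) e3 _ x1 y1.
- by move=> n; case: (Bx n).
- by rewrite subrr normr0.
- have : \forall n' \near \oo, [/\ (n < n')%N,
      forall i, (i < M)%N -> `|x n' i - y i| <= e / 3 &
      `|lim (y @ \oo) - lim (x n' @ \oo)| <= e / 9].
    near=> n'; split; near: n'.
    + exact: nbhs_infty_gt.
    + exact: near_le_coords.
    + by move/cvgrPdist_le : limxy; apply.
  move=> [n' _ /(_ n' (leqnn _)) [nn' hM hlim]].
  have cvgc a : c_set a -> a @ \oo --> lim (a @ \oo).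
    by move=> [l al]; have : cvg (a @ \oo) by apply/cvg_ex; exists l.
  have /cvgrPdist_le/(_ _ e9) [M1 _ h1] := cvgc _ cy.
  have /cvgrPdist_le/(_ _ e9) [M2 _ h2] := cvgc _ (Bx n').1.
  exists n', (maxn M (maxn M1 M2)); split=> //; first exact: leq_maxl.
  move=> i; rewrite !geq_max => /and3P[_ M1i M2i].
  have {h1} := h1 i M1i; have {h2} := h2 i M2i => /= h1 h2.
  have -> : x n' i - y i = (lim (y @ \oo) - y i) - (lim (x n' @ \oo) - x n' i)
     - (lim (y @ \oo) - lim (x n' @ \oo)) by ring.
  apply: le_trans (ler_normB _ _) _.
  have := ler_normB (lim (y @ \oo) - y i) (lim (x n' @ \oo) - x n' i).
  lra.
exists phi => //; apply: le_trans h _; lra.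
Unshelve. all: by end_near.
Qed.

Lemma wbs_c : wbs (@c_set R) (@supnorm R) (@c_ball R) = 0.
Proof.
apply: (wbs_eq0 supnorm_c_seminorm c_ballE) => x y e Bx [cy xy] e0.
apply: (coordwise_cvg_cca e0 Bx cy); first by move=> i; exact: (xy _ (c_coord_bdd i)).
exact: (xy _ c_lim_bdd).
Qed.

Lemma wbs_c0 : wbs (@c0_set R) (@supnorm R) (@c0_ball R) = 0.
Proof.
apply: (wbs_eq0 supnorm_c0_seminorm c0_ballE) => x y e Bx [cy xy] e0.
have Bx' n : c_ball (x n) by case: (Bx n) => /c0_sub_c.
have lim0 a : c0_set a -> lim (a @ \oo) = 0 by move=> a0; apply/cvg_lim.
apply: (coordwise_cvg_cca e0 Bx' (c0_sub_c cy)).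
  move=> i; apply: (xy (fun a => a i)); split => //; exists 1 => a /c0_sub_c ca.
  by rewrite mul1r supnorm_ge.
have -> : (fun n => lim (x n @ \oo)) = fun=> 0.
  by apply/funext => n; apply: lim0; case: (Bx n).
by rewrite lim0 //; exact: cvg_cst.
Qed.

(** Compactness of a product of intervals replaces a diagonal argument: a cluster point is
    approached on finitely many coordinates at arbitrarily late indices, which is what the gliding
    hump asks for. *)
Lemma bounded_coordwise_cluster x : (forall n i, `|x n i| <= 1) ->
  exists2 y : nat -> R, (forall i, `|y i| <= 1) &
    forall (e : R) n M, 0 < e -> exists2 n', (n < n')%N &
      forall i, (i < M)%N -> `|x n' i - y i| <= e.
Proof.
move=> x1; have [|y [y1 ycl]] := @tychonoff nat (fun=> R) (fun=> `[-1, 1]%classic)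
  (fun=> segment_compact (R := R) (a := -1) (b := 1)) (x @ \oo) _.
  by exists 0%N => // n _ i /=; rewrite in_itv /= -ler_norml.
exists y => [i|e n M e0]; first by have := y1 i; rewrite /= in_itv /= -ler_norml.
have nb : nbhs y [set z | forall i, (i < M)%N -> `|z i - y i| <= e].
  elim: M => [|M IH]; first by apply: filterE.
  have := @proj_continuous nat (fun=> R) M y _ (nbhsx_ballx (y M) e e0).
  move=> h; apply: filterS (filterI IH h) => z [zM hz] i.
  rewrite ltnS leq_eqVlt => /predU1P[->|]; last exact: zM.
  by move: hz; rewrite -ball_normE /ball_ /= distrC => /ltW.
have xn : (x @ \oo) [set x n' | n' in [set n' | (n < n')%N]].
  by exists n.+1 => // n' /= nn'; exists n'.
by have [_ [[n' nn' <-] h]] := ycl _ _ xn nb; exists n'.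
Qed.

(** Terms of the sequence are null, so the gliding hump runs with [a = 0] and [b] a coordinatewise
    cluster point; the segments have length at most 1. *)
Lemma bs_c0_le1 : bs (@supnorm R) (@c0_ball R) <= 1.
Proof.
apply: (bs_le supnorm_c0_seminorm c0_ballE) => x Bx.
have cx n : c_set (x n) by case: (Bx n) => /c0_sub_c.
have x1 n i : `|x n i| <= 1 by apply: ball_coord => //; case: (Bx n).
have [y y1 hy] := bounded_coordwise_cluster x1.
apply/ler_addgt0Pr => e e0; have e3 : 0 < e / 3 by rewrite divr_gt0.
have [||n M|phi iphi h] := @gliding_hump_cca x (fun=> 0) y 1 (e / 3) e3 cx x1.
- by move=> i; rewrite normr0.
- by move=> i; rewrite sub0r normrN.
- have [n' nn' hn'] := hy (e / 3) n M e3.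
  have /cvgrPdist_le/(_ _ e3) [M' _ hM'] := (Bx n').1.
  exists n', (maxn M M'); split=> //; first exact: leq_maxl.
  by move=> i; rewrite geq_max => /andP[_ /hM'] /=; rewrite distrC.
apply: (ccat_le supnorm_c0_seminorm _ iphi); first by move=> n; case: (Bx n).
apply: le_trans h _; lra.
Qed.

(** For [al = 1] and [be = 0] this is the summing basis of c_0. Coordinate [n] takes the value [al]
    on the terms from index [n] on and [be] on the earlier ones. *)
Let step_seq (al be : R) n i : R := if (i <= n)%N then al else be.

Let step_cvg al be n : step_seq al be n @ \oo --> be.
Proof.
apply: cvg_near_cst; exists n.+1 => // i /= ni.
by rewrite /step_seq leqNgt ni.
Qed.

Lemma bs_c0 : bs (@supnorm R) (@c0_ball R) = 1.
Proof.
apply/eqP; rewrite eq_le bs_c0_le1 /= -[leLHS]subr0.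
apply: (le_bs_of_functionals supnorm_c0_seminorm c0_ballE (x := step_seq 1 0)) => //.
  move=> n; split; first exact: step_cvg.
  by apply: supnorm_le => i; rewrite /step_seq; case: ifP; rewrite ?normr1 ?normr0.
move=> n m; exists (fun a => a n); split => //.
by move=> v /c0_sub_c; apply: supnorm_ge.
Qed.

(** In c the steps may go down to -1 instead of 0, which doubles the gap. *)
Lemma bs_c : bs (@supnorm R) (@c_ball R) = 2.
Proof.
apply/eqP; rewrite eq_le (bs_le2 supnorm_c_seminorm c_ballE) /=.
have -> : 2 = 1 - (-1) :> R by rewrite opprK.
apply: (le_bs_of_functionals supnorm_c_seminorm c_ballE (x := step_seq 1 (-1))).
- by lra.
- move=> n; split; first by exists (-1); apply: step_cvg.
  by apply: supnorm_le => i; rewrite /step_seq; case: ifP; rewrite ?normrN1 ?normr1.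
- move=> n m; exists (fun a => a n); split => //.
  by move=> v; apply: supnorm_ge.
Qed.

End SupNorm.

(** * The space [l_1] and its isomorphic copies *)

Section L1.
Variable R : realType.
Implicit Types (a v s : nat -> R) (M : nat -> nat).

Local Notation asum a n := (\sum_(0 <= i < n) `|a i|).

Lemma asum_homo a m n : (m <= n)%N -> asum a m <= asum a n.
Proof. by move=> mn; rewrite [leRHS](big_cat_nat (n := m)) //= lerDl sumr_ge0. Qed.

Lemma l1_cvg a : l1_set a -> series (fun i => `|a i|) @ \oo --> l1norm a.
Proof.
move=> [l al].
by have : cvg (series (fun i => `|a i|) @ \oo) by apply/cvg_ex; exists l.
Qed.

Lemma asum_le_l1norm a n : l1_set a -> asum a n <= l1norm a.
Proof.
move=> al; apply: (nondecreasing_cvgn_le (u_ := series (fun i => `|a i|))).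
  by move=> i j; apply: asum_homo.
by apply/cvg_ex; exists (l1norm a); apply: l1_cvg.
Qed.

Lemma l1_of_asum_le a (r : R) : (forall n, asum a n <= r) -> l1_set a /\ l1norm a <= r.
Proof.
move=> ar.
have cv : cvg (series (fun i => `|a i|) @ \oo).
  apply: nondecreasing_is_cvgn; first by move=> i j; apply: asum_homo.
  by exists r => _ [n _ <-]; apply: ar.
split; first by move/cvg_ex: cv.
by apply: limr_le => //; apply: nearW.
Qed.

Lemma l1norm_tail a (e : R) : l1_set a -> 0 < e -> exists n, forall m, (n <= m)%N ->
  l1norm a - asum a m <= e.
Proof.
move=> /l1_cvg/cvgrPdist_le h e0; have [n _ hn] := h e e0.
by exists n => m /hn /=; apply: le_trans; apply: ler_norm.
Qed.

Lemma l1_finite_support a n : (forall i, (n <= i)%N -> a i = 0) ->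
  l1_set a /\ forall m, (n <= m)%N -> l1norm a = asum a m.
Proof.
move=> a0.
have tl m : (n <= m)%N -> asum a m = asum a n.
  move=> nm; rewrite (big_cat_nat (n := n)) //= -[RHS]addr0; congr (_ + _).
  by rewrite big_nat_cond big1 // => i /andP[/andP[ni _] _]; rewrite a0 // normr0.
have [la le] : l1_set a /\ l1norm a <= asum a n.
  apply: l1_of_asum_le => m; have [mn|nm] := leqP m n; first exact: asum_homo.
  by rewrite (tl m) // ltnW.
split=> // m nm; apply/eqP; rewrite eq_le asum_le_l1norm // andbT.
by rewrite tl.
Qed.

Lemma l1norm_seminorm : seminorm_on (@l1_set R) (@l1norm R).
Proof.
have hD u v : l1_set u -> l1_set v -> l1_set (u + v) /\ l1norm (u + v) <= l1norm u + l1norm v.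
  move=> lu lv; apply: l1_of_asum_le => n.
  apply: le_trans (_ : asum u n + asum v n <= _); last by rewrite lerD ?asum_le_l1norm.
  by rewrite -big_split /=; apply: ler_sum => i _; apply: ler_normD.
have hZ (r : R) u : l1_set u -> l1_set (r *: u) /\ l1norm (r *: u) <= `|r| * l1norm u.
  move=> lu; apply: l1_of_asum_le => n.
  apply: le_trans (_ : `|r| * asum u n <= _); last by rewrite ler_wpM2l ?asum_le_l1norm.
  by rewrite mulr_sumr; apply: ler_sum => i _; rewrite -normrM.
apply: seminorm_on_of_le.
- split; first by have [] := @l1_finite_support 0 0 _.
  by move=> r u v lu lv; have [] := hD _ _ (hZ r u lu).1 lv.
- by move=> u lu; have := asum_le_l1norm 0 lu; rewrite big_geq.
- by move=> u v lu lv; have [] := hD u v lu lv.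
- by move=> r u lu; have [] := hZ r u lu.
Qed.

Let hN := l1norm_seminorm.
Let hS := seminorm_subspace hN.

Lemma l1_ballE v : @l1_ball R v <-> l1_set v /\ l1norm v <= 1. Proof. by []. Qed.

(** The blocks are disjoint, so the prescriptions never conflict; outside all blocks the value is
    0. *)
Lemma blockwise_def M (t : nat -> nat -> R) : (forall j, (M j <= M j.+1)%N) ->
  (forall j i, `|t j i| <= 1) ->
  exists2 s, (forall i, `|s i| <= 1) & forall j i, (M j <= i < M j.+1)%N -> s i = t j i.
Proof.
move=> Mi t1.
have Mm : {homo M : j k / (j <= k)%N} by apply: homo_leq => //; apply: leq_trans.
suff /choice[s hs] : forall i, exists y, `|y| <= 1 /\
    forall j, (M j <= i < M j.+1)%N -> y = t j i.
  by exists s => [i|j i]; [case: (hs i)|case: (hs i) => _; apply].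
move=> i; have [[j hj]|nj] := pselect (exists j, (M j <= i < M j.+1)%N); last first.
  by exists 0; rewrite normr0; split => // j hj; case: nj; exists j.
exists (t j i); split => // k hk; congr (t _ i).
have lt m p : (M m <= i < M m.+1)%N -> (M p <= i < M p.+1)%N -> ~ (m < p)%N.
  by move=> /andP[_ im] /andP[pi _] /Mm; rewrite leqNgt (leq_ltn_trans pi im).
by have [jk|kj|//] := ltngtP j k; [case: (lt j k hj hk jk)|case: (lt k j hk hj kj)].
Qed.

(** Pair with the signs of the blocks, reversed on the blocks before [n]. Cutting at [M m.+1] leaves
    a finite sum, hence a functional linear on all sequences. *)
Lemma block_functional (z : nat -> nat -> R) M n m :
  (forall j, (M j <= M j.+1)%N) ->
  (forall j i, ~~ (M j <= i < M j.+1)%N -> z j i = 0) -> (forall j, l1norm (z j) = 1) ->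
  exists F : (nat -> R) -> R, [/\ linear_on setT F,
    (forall v, l1_set v -> `|F v| <= l1norm v) &
    forall j, (j <= m)%N -> F (z j) = if (n <= j)%N then 1 else -1].
Proof.
move=> Mi z0 z1.
have Mm : {homo M : j k / (j <= k)%N} by apply: homo_leq => //; apply: leq_trans.
pose eps j : R := if (n <= j)%N then 1 else -1.
have [|s s1 hs] := @blockwise_def M (fun j i => eps j * Num.sg (z j i)) Mi.
  move=> j i; rewrite normrM /eps normr_sg.
  by case: ifP; rewrite ?normrN1 ?normr1 mul1r lern1 leq_b1.
exists (fun v => \sum_(0 <= i < M m.+1) s i * v i); split.
- move=> r u v _ _; rewrite mulr_sumr -big_split; apply: eq_bigr => i _ /=.
  by rewrite -[(r *: u + v) i]/(r * u i + v i); ring.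
- move=> v lv; apply: le_trans (asum_le_l1norm (M m.+1) lv).
  apply: le_trans (ler_norm_sum _ _ _) _; apply: ler_sum => i _.
  by rewrite normrM ler_piMl.
- move=> j jm; rewrite -/(eps j).
  have -> : \sum_(0 <= i < M m.+1) s i * z j i = eps j * asum (z j) (M m.+1).
    rewrite mulr_sumr; apply: eq_bigr => i _.
    have [b|/z0 ->] := boolP (M j <= i < M j.+1)%N; last by rewrite normr0 !mulr0.
    by rewrite (hs _ _ b) -mulrA normrEsg.
  have [|_ <-] := @l1_finite_support (z j) (M j.+1); last by apply: Mm.
    by move=> i ij; apply: z0; rewrite negb_and -!leqNgt ij orbT.
  by rewrite z1 mulr1.
Qed.

Definition l1_unit n : nat -> R := fun i => (i == n)%:R.

Lemma l1norm_unit n : l1_set (l1_unit n) /\ l1norm (l1_unit n) = 1.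
Proof.
have [|ln h] := @l1_finite_support (l1_unit n) n.+1.
  by move=> i ni; rewrite /l1_unit gtn_eqF.
split=> //; rewrite (h _ (leqnn _)) big_nat_recr //= /l1_unit eqxx normr1.
by rewrite big_nat_cond big1 ?add0r // => i /andP[/andP[_ ni] _]; rewrite ltn_eqF // normr0.
Qed.

Lemma bs_l1 : bs (@l1norm R) (@l1_ball R) = 2.
Proof.
apply/eqP; rewrite eq_le (bs_le2 hN l1_ballE) /=.
have -> : 2 = 1 - (-1) :> R by rewrite opprK.
apply: (le_bs_of_functionals hN l1_ballE (x := l1_unit)); first by lra.
  by move=> n; have [l1u u1] := l1norm_unit n; split; rewrite ?u1.
move=> n m; apply: (@block_functional l1_unit id) => // [j i|j]; last by case: (l1norm_unit j).
rewrite /l1_unit; case: eqP => //= ->; by rewrite leqnn ltnSn.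
Qed.

(** * Pairing with bounded sequences and Schur's property of [l_1] *)

Definition l1_pairing s v := lim (series (fun i => s i * v i) @ \oo).

Lemma l1_pairing_cvg s v : (forall i, `|s i| <= 1) -> l1_set v ->
  cvg (series (fun i => s i * v i) @ \oo).
Proof.
move=> s1 lv; apply: normed_cvg.
have [[l hl] _] : l1_set (fun i => s i * v i) /\ l1norm (fun i => s i * v i) <= l1norm v.
  apply: l1_of_asum_le => n; apply: le_trans (asum_le_l1norm n lv).
  by apply: ler_sum => i _; rewrite normrM ler_piMl.
by apply/cvg_ex; exists l.
Qed.

Lemma l1_pairing_bdd s : (forall i, `|s i| <= 1) ->
  bdd_lin_fun (@l1_set R) (@l1norm R) (l1_pairing s).
Proof.
move=> s1; split=> [r u v lu lv|].
  have cu := l1_pairing_cvg s1 lu; have cv := l1_pairing_cvg s1 lv.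
  apply/cvg_lim => //.
  have -> : series (fun i => s i * (r *: u + v) i) =
      (fun n => r *: series (fun i => s i * u i) n + series (fun i => s i * v i) n).
    apply/funext => n; rewrite /series /= scaler_sumr -big_split; apply: eq_bigr => i _ /=.
    rewrite -[(r *: u + v) i]/(r * u i + v i) -[r *: _]/(r * (s i * u i)); ring.
  by apply: cvgD => //; apply: cvgZr.
exists 1 => v lv; rewrite mul1r.
have b n : `|series (fun i => s i * v i) n| <= l1norm v.
  apply: le_trans (asum_le_l1norm n lv).
  apply: le_trans (ler_norm_sum _ _ _) _; apply: ler_sum => i _.
  by rewrite normrM ler_piMl.
have cv := l1_pairing_cvg s1 lv.
rewrite ler_norml; apply/andP; split.
  by apply: limr_ge => //; apply: nearW => n; have := b n; rewrite ler_norml => /andP[].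
by apply: limr_le => //; apply: nearW => n; have := b n; rewrite ler_norml => /andP[].
Qed.

Lemma near_asum_le (z : nat -> nat -> R) : (forall i, (fun n => z n i) @ \oo --> 0) ->
  forall (k : nat) (e : R), 0 < e -> \forall n \near \oo, asum (z n) k <= e.
Proof.
move=> z0; elim=> [|M IH] e e0; first by apply: nearW => n; rewrite big_geq // ltW.
have e2 : 0 < e / 2 by rewrite divr_gt0.
have hM := IH _ e2; have /cvgrPdist_le/(_ _ e2) hz := z0 M.
near=> n; rewrite big_nat_recr //= [e]splitr lerD //; first by near: n.
by rewrite -normrN -[- _]sub0r; near: n.
Unshelve. all: by end_near.
Qed.

(* Schur's gliding hump: the signs of the humps define a functional which stays away
   from 0 along them. *)
Lemma weakly_null_l1_small (z : nat -> nat -> R) (e : R) n0 : 0 < e ->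
  (forall n, l1_set (z n)) ->
  (forall f, bdd_lin_fun (@l1_set R) (@l1norm R) f -> (fun n => f (z n)) @ \oo --> 0) ->
  exists2 n, (n0 < n)%N & l1norm (z n) <= e.
Proof.
move=> e0 lz wz; apply: contrapT => hn.
have big n : (n0 < n)%N -> e < l1norm (z n).
  by move=> n0n; rewrite ltNge; apply/negP => h; apply: hn; exists n.
(* Head and tail of a hump have mass at most [d] each; they are missing from the middle and may also
   count against it, which leaves at least [e - 4 * d = d]. *)
pose d := e / 5; have d0 : 0 < d by rewrite divr_gt0.
have z0 i : (fun n => z n i) @ \oo --> 0.
  apply: (wz (fun a => a i)); split => //; exists 1 => v lv; rewrite mul1r.
  apply: le_trans (asum_le_l1norm i.+1 lv).
  by rewrite big_nat_recr //= lerDr sumr_ge0.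
(* A state is an index and a cutoff: the next term has little mass before the old cutoff and little
   after the new one. *)
pose Q (p q : nat * nat) := [/\ (maxn n0 p.1 < q.1)%N, (p.2 <= q.2)%N,
  asum (z q.1) p.2 <= d & l1norm (z q.1) - asum (z q.1) q.2 <= d].
have [|u [_ hu]] := @iter_choice _ Q (0%N, 0%N).
  move=> [n M].
  have : \forall n' \near \oo, (maxn n0 n < n')%N /\ asum (z n') M <= d.
    by near=> n'; split; near: n'; [exact: nbhs_infty_gt|exact: near_asum_le].
  move=> [n' _ /(_ n' (leqnn _)) [nn' hM]].
  have [M' hM'] := l1norm_tail (lz n') d0.
  exists (n', maxn M M'); split => //=; first exact: leq_maxl.
  by apply: hM'; apply: leq_maxr.
pose phi k := (u k.+1).1; pose L k := (u k).2.
have Li k : (L k <= L k.+1)%N by case: (hu k).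
have [|s s1 hs] := @blockwise_def L (fun k i => Num.sg (z (phi k) i)) Li.
  by move=> k i; rewrite normr_sg lern1 leq_b1.
have lephi k : (k <= phi k)%N.
  elim: k => // k IH; apply: leq_ltn_trans IH _.
  by have [] := hu k.+1; rewrite gtn_max => /andP[].
have n0phi k : (n0 < phi k)%N by have [] := hu k; rewrite gtn_max => /andP[].
have f_big k : d <= l1_pairing s (z (phi k)).
  apply: limr_ge; first exact: l1_pairing_cvg.
  exists (L k.+1) => // n /= Ln.
  have [_ _ head tail] := hu k.
  rewrite -/(phi k) -/(L k) -/(L k.+1) in head tail.
  rewrite /series /= (big_cat_nat (n := L k.+1)) //= (big_cat_nat (n := L k)) //=.
  have mid : \sum_(L k <= i < L k.+1) s i * z (phi k) i =
      asum (z (phi k)) (L k.+1) - asum (z (phi k)) (L k).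
    rewrite [X in _ = X - _](big_cat_nat (n := L k)) //= addrAC subrr add0r.
    by apply: eq_big_nat => i hi; rewrite (hs _ _ hi) -normrEsg.
  have lead : `|\sum_(0 <= i < L k) s i * z (phi k) i| <= asum (z (phi k)) (L k).
    apply: le_trans (ler_norm_sum _ _ _) _; apply: ler_sum => i _.
    by rewrite normrM ler_piMl.
  have rest : `|\sum_(L k.+1 <= i < n) s i * z (phi k) i| <=
      l1norm (z (phi k)) - asum (z (phi k)) (L k.+1).
    rewrite lerBrDl; apply: le_trans (asum_le_l1norm n (lz (phi k))).
    rewrite [leRHS](big_cat_nat (n := L k.+1)) //= lerD2l.
    apply: le_trans (ler_norm_sum _ _ _) _; apply: ler_sum => i _.
    by rewrite normrM ler_piMl.
  rewrite mid; have := big _ (n0phi k).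
  have aux (A B G H N : R) : `|A| <= G -> `|B| <= N - H -> G <= d -> N - H <= d -> e < N ->
     d <= A + (H - G) + B.
    by rewrite !ler_norml /d => /andP[? ?] /andP[? ?]; lra.
  exact: aux lead rest head tail.
have d2 : 0 < d / 2 by rewrite divr_gt0.
have /cvgrPdist_le/(_ _ d2) [N _ hN'] := wz _ (l1_pairing_bdd s1).
have := hN' (phi N) (lephi N); rewrite /= sub0r normrN => h.
have := le_trans (f_big N) (le_trans (ler_norm _) h); lra.
Unshelve. all: by end_near.
Qed.

(** Schur's argument applied to [x n - y] gives a subsequence within [e / 2] of [y]; by convexity
    its Cesaro means stay there. *)
Lemma wbs_l1 : wbs (@l1_set R) (@l1norm R) (@l1_ball R) = 0.
Proof.
apply: (wbs_eq0 hN l1_ballE) => x y e Bx [ly xy] e0.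
have lx n : l1_set (x n) by case: (Bx n).
have e2 : 0 < e / 2 by rewrite divr_gt0.
pose Q n n' := (n < n')%N /\ l1norm (x n' - y) <= e / 2.
have [n|u [_ hu]] := @iter_choice _ Q 0%N.
  have [||n' nn' h] := @weakly_null_l1_small (fun n => x n - y) (e / 2) n e2.
  - by move=> k; apply: subspaceB.
  - move=> f bf; have lf := bf.1.
    have -> : (fun k => f (x k - y)) = (fun k => f (x k) - f y).
      by apply/funext => k; rewrite (linear_onB hS lf).
    by rewrite -(subrr (f y)); apply: cvgB; [exact: xy|exact: cvg_cst].
  - by exists n'.
(* The shift drops the arbitrary starting index, which need not be close to [y]. *)
exists (fun n => u n.+1); first by move=> n; case: (hu n.+1).
have lxu n : l1_set ((x \o (fun n => u n.+1)) n) by apply: lx.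
have lc k : l1_set (cesaro (x \o (fun n => u n.+1)) k).
  exact: (subspace_cesaro hN).
apply: (@ca_le _ _ _ _ hN _ _ 0) => // k l _ _.
have cl m : l1norm (cesaro (x \o (fun n => u n.+1)) m - y) <= e / 2.
  by apply: (seminorm_cesaroB_le hN) => // n; case: (hu n).
move: (cesaro _ k) (cesaro _ l) (lc k) (lc l) (cl k) (cl l) => A B lA lB hA hB.
have -> : A - B = (A - y) - (B - y) by rewrite opprB addrA subrK.
apply: le_trans (seminormB hN _ _) _; try exact: subspaceB.
by rewrite [e]splitr lerD.
Qed.

(** * Spans of the unit vectors from [n] on, and James's distortion theorem *)

Definition finite_from n : set (nat -> R) :=
  [set a | exists m, forall i, ~~ (n <= i < m)%N -> a i = 0].

Lemma finite_from_l1 n a : finite_from n a -> l1_set a.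
Proof.
move=> [M h]; have [] // := @l1_finite_support a M _ => i Mi.
by apply: h; rewrite negb_and -!leqNgt Mi orbT.
Qed.

Lemma finite_from_subspace n : subspace (finite_from n).
Proof.
split; first by exists 0%N.
move=> r u v [M hM] [M' hM']; exists (maxn M M') => i hi.
rewrite -[LHS]/(r * u i + v i) hM ?hM' ?mulr0 ?addr0 //.
  by apply: contra hi => /andP[-> /=]; rewrite leq_max orbC => ->.
by apply: contra hi => /andP[-> /=]; rewrite leq_max => ->.
Qed.

Lemma finite_from_unit n : finite_from n (l1_unit n).
Proof.
exists n.+1 => i; rewrite /l1_unit; case: eqP => // ->; by rewrite leqnn ltnSn.
Qed.

(* James's distortion theorem: beyond some index [T] is almost a multiple [K] of an
   isometry from below, and it almost attains [K] on arbitrarily late blocks. *)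
Lemma james_distortion (X : normedModType R) (T : (nat -> R) -> X) (c C eta : R) :
  0 < c -> 0 < eta -> eta < 1 ->
  (forall (k : R) a b, l1_set a -> l1_set b -> T (k *: a + b) = k *: T a + T b) ->
  (forall a, l1_set a -> c * l1norm a <= `|T a| /\ `|T a| <= C * l1norm a) ->
  exists (K : R) (n0 : nat), [/\ 0 < K,
    (forall a, finite_from n0 a -> eta * K * l1norm a <= `|T a|) &
    forall n, exists2 a, finite_from n a & l1norm a = 1 /\ `|T a| <= K / eta].
Proof.
move=> c0 eta0 eta1 lT bT.
pose E n := [set `|T a| | a in [set a | finite_from n a /\ l1norm a = 1]].
have E0 n : E n !=set0.
  by exists `|T (l1_unit n)|; exists (l1_unit n) => //; split;
    [exact: finite_from_unit|case: (l1norm_unit n)].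
have Elb n : lbound (E n) c.
  by move=> _ [a [fa a1] <-]; have [+ _] := bT a (finite_from_l1 fa); rewrite a1 mulr1.
(* The best lower constant of [T] on the span from [n] on. With [K] its supremum, some [k n0]
   exceeds [eta * K], and every [k n] is below [K / eta], which yields almost minimal vectors
   arbitrarily late. *)
pose k n := inf (E n).
have ck n : c <= k n by apply: lb_le_inf => //; apply: Elb.
have kC n : k n <= C.
  apply: le_trans (_ : `|T (l1_unit n)| <= C).
    apply: ge_inf; first by exists c; apply: Elb.
    by exists (l1_unit n) => //; split; [exact: finite_from_unit|case: (l1norm_unit n)].
  by have [l1u u1] := l1norm_unit n; have [_] := bT _ l1u; rewrite u1 mulr1.
pose K := sup (range k).
have kub : has_ubound (range k) by exists C => _ [n _ <-].
have kK n : k n <= K by apply: ub_le_sup => //; exists n.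
have K0 : 0 < K by apply: lt_le_trans c0 (le_trans (ck 0%N) (kK 0%N)).
have [n0 hn0] : exists n0, eta * K < k n0.
  have e0 : 0 < K - eta * K by rewrite subr_gt0 gtr_pMl.
  have [|_ [n _ <-] h] := @sup_adherent _ (range k) _ e0.
    by split => //; exists (k 0%N); exists 0%N.
  by exists n; move: h; rewrite -/K opprB addrC subrK.
exists K, n0; split=> // [a fa|n].
  have la := finite_from_l1 fa.
  have [a0|a0] := eqVneq (l1norm a) 0; first by rewrite a0 mulr0.
  have ap : 0 < l1norm a by rewrite lt0r a0 (seminorm_ge0 hN la).
  pose b := (l1norm a)^-1 *: a.
  have lb : l1_set b by apply: (subspaceZ _ hS).
  have aE : a = l1norm a *: b + 0 by rewrite addr0 scalerA mulfV // scale1r.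
  have T0 : T 0 = 0.
    have := lT 1 0 0 hS.1 hS.1; rewrite !scale1r addr0 => /eqP.
    by rewrite -subr_eq0 opprD addNKr oppr_eq0 => /eqP.
  have -> : `|T a| = l1norm a * `|T b|.
    by rewrite {1}aE lT //; [rewrite T0 addr0 normrZ gtr0_norm|exact: hS.1].
  rewrite mulrC ler_wpM2l ?(ltW ap) //; apply: le_trans (ltW hn0) _.
  apply: ge_inf; first by exists c; apply: Elb.
  exists b => //; split; first exact: subspaceZ (finite_from_subspace _) fa.
  by rewrite (seminormZ hN) // gtr0_norm ?invr_gt0 // mulVf.
have [|_ [a [fa a1] <-] h] := @inf_lt _ (E n) (K / eta) (E0 n).
  by apply: le_lt_trans (kK n) _; rewrite ltr_pdivlMr // gtr_pMr.
by exists a => //; split => //; apply: ltW.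
Qed.

(** Images of late blocks scaled by [eta / K] lie in the unit ball. For a difference [w] of Cesaro
    means of the blocks, the norm of [T w] is at least [eta * K] times the l_1 norm of [w], which
    the block functional bounds below; the gap is [2 * eta ^+ 2]. *)
Lemma contains_l1_bs (X : normedModType R) : @contains_l1 R X ->
  bs (@Xnorm R X) (@unit_ball R X) = 2.
Proof.
move=> [T [c [C [c0 [lT bT]]]]].
have hX := Xnorm_seminorm X.
have XE (v : X) : unit_ball v <-> [set: X] v /\ Xnorm v <= 1 by split => [|[]].
apply/eqP; rewrite eq_le (bs_le2 hX XE) /=.
suff main (eta : R) : 0 < eta -> eta < 1 -> 2 * eta ^+ 2 <= bs (@Xnorm R X) (@unit_ball R X).
  apply/ler_addgt0Pr => e e0; rewrite -lerBlDr.
  (* From [eta ^+ 2 >= 2 * eta - 1] one gets [2 * eta ^+ 2 >= 2 - e]. *)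
  pose eta := Num.max (1 - e / 4) (1 / 2).
  have eta0 : 0 < eta by rewrite lt_max divr_gt0 ?orbT.
  have eta1 : eta < 1 by rewrite gt_max; apply/andP; split; lra.
  have etae : 1 - e / 4 <= eta by rewrite le_max lexx.
  apply: le_trans (main eta eta0 eta1).
  have := sqr_ge0 (eta - 1); rewrite sqrrB1; lra.
move=> eta0 eta1.
have [K [n0 [K0 lowT block]]] := james_distortion c0 eta0 eta1 lT bT.
(* A state is a block with its right end, where the next block may start; starting from [n0] keeps
   every block in the range of the lower estimate. *)
pose Q (p q : (nat -> R) * nat) := [/\ (p.2 <= q.2)%N,
  forall i, ~~ (p.2 <= i < q.2)%N -> q.1 i = 0, l1norm q.1 = 1 & `|T q.1| <= K / eta].
have [|u [u0 hu]] := @iter_choice _ Q (0, n0).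
  move=> [z n]; have [a [M hM] [a1 Ta]] := block n.
  exists (a, maxn n M); split => //=; first exact: leq_maxl.
  by move=> i hi; apply: hM; apply: contra hi => /andP[-> /=]; rewrite leq_max orbC => ->.
pose z j := (u j.+1).1; pose M j := (u j).2.
have Mi j : (M j <= M j.+1)%N by case: (hu j).
have Mn0 j : (n0 <= M j)%N.
  by elim: j => [|j IH]; [rewrite /M u0|exact: leq_trans (Mi j)].
have zM j i : ~~ (M j <= i < M j.+1)%N -> z j i = 0 by case: (hu j) => _ h _ _; apply: h.
have z1 j : l1norm (z j) = 1 by case: (hu j).
have Tz j : `|T (z j)| <= K / eta by case: (hu j).
have zfin j : finite_from n0 (z j).
  exists (M j.+1) => i hi; apply: zM; apply: contra hi => /andP[ji ->].
  by rewrite (leq_trans (Mn0 j) ji).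
have hF := finite_from_subspace n0.
have zl j : l1_set (z j) := finite_from_l1 (zfin j).
pose y j := (eta / K) *: T (z j).
have eK0 : 0 < eta / K by rewrite divr_gt0.
have T0 : T 0 = 0.
  have := lT 1 0 0 hS.1 hS.1; rewrite !scale1r addr0 => /eqP.
  by rewrite -subr_eq0 opprD addNKr oppr_eq0 => /eqP.
have TD a b : l1_set a -> l1_set b -> T (a + b) = T a + T b.
  by move=> la lb; have := lT 1 a b la lb; rewrite !scale1r.
have TZ (r : R) a : l1_set a -> T (r *: a) = r *: T a.
  by move=> la; have := lT r a 0 la hS.1; rewrite T0 !addr0.
have TC phi k : cesaro (y \o phi) k = (eta / K) *: T (cesaro (z \o phi) k).
  have lzp i : l1_set ((z \o phi) i) by apply: zl.
  rewrite TZ; last exact: (subspace_sum k.+1 hS lzp).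
  rewrite scalerA mulrC -scalerA; congr (_ *: _).
  elim: (k.+1) => [|m IH]; first by rewrite !big_ord0 T0 scaler0.
  rewrite !big_ord_recr /= IH TD ?scalerDr //; exact: (subspace_sum m hS lzp).
apply: (le_bs_of_gap hX XE (x := y)); first by rewrite mulr_ge0 ?sqr_ge0.
  move=> j; rewrite /unit_ball /= normrZ gtr0_norm // -ler_pdivlMl // mulr1 invf_div.
  exact: Tz.
move=> phi k l iphi kl.
have [F [lF FN Fz]] := block_functional (phi k.+1) (phi l) Mi zM z1.
set w := cesaro (z \o phi) k - cesaro (z \o phi) l.
have zpfin i : finite_from n0 ((z \o phi) i) by apply: zfin.
have zpl i : l1_set ((z \o phi) i) by apply: zl.
have wfin : finite_from n0 w.
  by apply: subspaceB => //; apply: subspaceZ => //; apply: (subspace_sum _ hF zpfin).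
have -> : cesaro (y \o phi) k - cesaro (y \o phi) l = (eta / K) *: T w.
  have lck m : l1_set (cesaro (z \o phi) m) by apply: (subspace_cesaro hN).
  rewrite !TC -scalerBr; congr (_ *: _).
  rewrite /w -[- cesaro (z \o phi) l]scaleN1r TD //; last exact: (subspaceZ _ hS).
  by rewrite (TZ (-1)) // scaleN1r.
rewrite /Xnorm normrZ gtr0_norm // -ler_pdivrMl // invf_div.
apply: le_trans (lowT w wfin).
have wF := FN w (finite_from_l1 wfin).
have wE : `|F w| = 2 * ((l - k)%:R / l.+1%:R).
  rewrite (cesaro_gap_functional lF iphi kl Fz) opprK ger0_norm //.
apply: le_trans (ler_wpM2l _ wF); last by rewrite mulr_ge0 // ltW.
rewrite wE le_eqVlt; apply/orP; left; apply/eqP.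
have := lt0r_neq0 eta0; have : l.+1%:R != 0 :> R by rewrite pnatr_eq0.
by move: (l.+1%:R) ((l - k)%:R) => p q p0 h0; field; apply/andP.
Qed.

End L1.

Theorem theorem5p2 (R : realType) :
  ( (forall X : completeNormedModType R,
        @contains_l1 R X -> bs (@Xnorm R X) (@unit_ball R X) = 2)
    /\ bs (@l1norm R) (@l1_ball R) = 2
    /\ wbs (@l1_set R) (@l1norm R) (@l1_ball R) = 0 )
  /\
  ( (forall X : completeNormedModType R,
        ~ @reflexive_space R X -> ~ @contains_l1 R X ->
        1 <= bs (@Xnorm R X) (@unit_ball R X) <= 2)
    /\ bs (@supnorm R) (@c0_ball R) = 1
    /\ bs (@supnorm R) (@c_ball R) = 2
    /\ wbs (@c0_set R) (@supnorm R) (@c0_ball R) = 0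
    /\ wbs (@c_set R) (@supnorm R) (@c_ball R) = 0 ).
Proof.
split; split.
- by move=> X; apply: contains_l1_bs.
- by split; [exact: bs_l1|exact: wbs_l1].
- move=> X nR _; apply/andP; split; first exact: nonreflexive_bs_ge1.
  by apply: (bs_le2 (Xnorm_seminorm X)) => v; split => [|[]].
- by split; [exact: bs_c0|split; [exact: bs_c|split; [exact: wbs_c0|exact: wbs_c]]].
Qed.
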